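(* Let $S,T$ be disjoint finite sets, $V=S\cup T$, let $f_V=(f_S,f_T):V\to\mathbb{Z}\cup\{-\infty\}$ and $g_V=(g_S,g_T):V\to\mathbb{Z}\cup\{+\infty\}$ with $f_V\le g_V$, let $p_T$ be a positively intersecting supermodular function on $T$ with $p_T(\emptyset)=0$ and $p_T(Y)\le|S|$ for every $Y\subseteq T$, and let $\alpha\le\beta$ be non-negative integers. Suppose that $\widetilde f_T(Y)-|X||Y|+\widetilde p_T(\mathcal T)-|\mathcal T||X|\le\widetilde g_S(S-X)$ and $\widetilde f_S(X)-|X||Y|+\widetilde p_T(\mathcal T)-|\mathcal T||X|\le\widetilde g_T(T-Y)$ hold for every $X\subseteq S$, $Y\subseteq T$ and subpartition $\mathcal T$ of $T-Y$. Then there is a simple bipartite graph $G=(S,T;E)$ covering $p_T$ (i.e. $|\Gamma_G(Y)|\ge p_T(Y)$ for all $Y\subseteq T$) with $f_V(v)\le d_G(v)\le g_V(v)$ for all $v\in V$, and: (A) with $\alpha\le|E|$ if and only if $$\widetilde g_S(S-X)+\widetilde g_T(T-Y)+|X||Y|-[\widetilde p_T(\mathcal T)-|X||\mathcal T|]\ge\alpha\quad(\ast)$$ whenever $X\subseteq S$, $Y\subseteq T$, and $\mathcal T$ is a subpartition of $T-Y$; (B) with $|E|\le\beta$ if and only if $$\widetilde f_S(X)+\widetilde f_T(Y)-|X||Y|+\widetilde p_T(\mathcal T)-|X||\mathcal T|\le\beta\quad(\ast\ast)$$ whenever $X\subseteq S$, $Y\subseteq T$, and $\mathcal T$ is a subpartition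 of $T-Y$; (AB) with $\alpha\le|E|\le\beta$ if and only if both $(\ast)$ and $(\ast\ast)$ hold. When $p_T$ is fully supermodular, it suffices to require the two conditions only for subpartitions $\mathcal T$ with at most one member. If $p_T$ is fully supermodular and monotone non-decreasing, it suffices to require them only for $\mathcal T=\emptyset$ and $\mathcal T=\{T-Y\}$.
   Context: A bipartite graph is simple if it has no parallel edges; $\Gamma_G(Y)$ is the set of nodes of $S$ adjacent to some node of $Y$; $d_G(v)$ is the degree. $\widetilde h(X)=\sum_{v\in X}h(v)$. A subpartition is a family of pairwise disjoint nonempty subsets (possibly empty, with $\widetilde p_T(\emptyset)=0$); $\widetilde p_T(\mathcal T)=\sum_{W\in\mathcal T}p_T(W)$. $p_T$ is positively intersecting supermodular if $p_T(X)+p_T(Y)\le p_T(X\cap Y)+p_T(X\cup Y)$ whenever $X\cap Y\ne\emptyset$, $p_T(X)>0$, $p_T(Y)>0$; fully supermodular if this holds for all $X,Y$; monotone non-decreasing if $p_T(X)\le p_T(Y)$ whenever $\emptyset\subset X\subseteq Y\subseteq T$. *)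

(* Defs.v *)
From mathcomp Require Import all_boot all_order all_algebra.
From mathcomp Require Import constructive_ereal.

Set Implicit Arguments.
Unset Strict Implicit.
Unset Printing Implicit Defensive.

Import Order.TTheory GRing.Theory Num.Theory.
Local Open Scope ring_scope.

(* The integers with infinities are [\bar int]. With f <> +oo and g <> -oo
   everywhere, no sum below mixes +oo and -oo. *)

(* A family of pairwise disjoint nonempty subsets of A; it may be empty and
   need not cover A. *)
Definition subpartition (T : finType) (P : {set {set T}}) (A : {set T}) : bool :=
  [&& cover P \subset A, trivIset P & set0 \notin P].

Section SetFunctions.
Variables (T : finType) (p : {set T} -> int).

Definition supermodular_at (X Y : {set T}) : Prop :=
  p X + p Y <= p (X :&: Y) + p (X :|: Y).

Definition pos_intersecting_supermodular : Prop :=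
  forall X Y : {set T},
    X :&: Y != set0 -> 0 < p X -> 0 < p Y -> supermodular_at X Y.

Definition fully_supermodular : Prop :=
  forall X Y : {set T}, supermodular_at X Y.

Definition monotone_nondecreasing : Prop :=
  forall X Y : {set T}, X != set0 -> X \subset Y -> p X <= p Y.

End SetFunctions.

(* A simple bipartite graph (S, T; E) is given by its edge set E as a set of
   pairs, and the node set V is the disjoint sum S + T. *)
Section BipartiteGraphs.
Variables (S T : finType) (E : {set S * T}).

Definition neighbours (Y : {set T}) : {set S} :=
  [set s | [exists t in Y, (s, t) \in E]].

Definition degree (v : S + T) : nat :=
  match v with
  | inl s => #|[set t | (s, t) \in E]|
  | inr t => #|[set s | (s, t) \in E]|
  end.

Definition covers (p : {set T} -> int) : Prop :=
  forall Y : {set T}, p Y <= #|neighbours Y|%:Z.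

Definition degree_constrained (f g : S + T -> \bar int) : Prop :=
  forall v : S + T,
    (f v <= (degree v)%:Z%:E)%E /\ ((degree v)%:Z%:E <= g v)%E.

End BipartiteGraphs.

Section Conditions.
Variables (S T : finType) (f g : S + T -> \bar int) (p : {set T} -> int).

Definition sumS (h : S + T -> \bar int) (X : {set S}) : \bar int :=
  (\sum_(s in X) h (inl s))%E.

Definition sumT (h : S + T -> \bar int) (Y : {set T}) : \bar int :=
  (\sum_(t in Y) h (inr t))%E.

Definition sumP (P : {set {set T}}) : int := \sum_(W in P) p W.

(* Every condition below ranges over triples (X, Y, P) with P a subpartition
   of T - Y; [adm Y P] selects the subpartitions for which it is required. *)
Variable adm : {set T} -> {set {set T}} -> bool.

Definition feasibility_condition : Prop :=
  forall (X : {set S}) (Y : {set T}) (P : {set {set T}}),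
    subpartition P (~: Y) -> adm Y P ->
    (sumT f Y - (#|X| * #|Y|)%:Z%:E + (sumP P)%:E - (#|P| * #|X|)%:Z%:E
       <= sumS g (~: X))%E /\
    (sumS f X - (#|X| * #|Y|)%:Z%:E + (sumP P)%:E - (#|P| * #|X|)%:Z%:E
       <= sumT g (~: Y))%E.

Definition lower_condition (alpha : nat) : Prop :=
  forall (X : {set S}) (Y : {set T}) (P : {set {set T}}),
    subpartition P (~: Y) -> adm Y P ->
    (alpha%:Z%:E <= sumS g (~: X) + sumT g (~: Y) + (#|X| * #|Y|)%:Z%:E
                    - (sumP P - (#|X| * #|P|)%:Z)%:E)%E.

Definition upper_condition (beta : nat) : Prop :=
  forall (X : {set S}) (Y : {set T}) (P : {set {set T}}),
    subpartition P (~: Y) -> adm Y P ->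
    (sumS f X + sumT f Y - (#|X| * #|Y|)%:Z%:E
       + (sumP P)%:E - (#|X| * #|P|)%:Z%:E <= beta%:Z%:E)%E.

Definition realization (E : {set S * T}) : Prop :=
  covers E p /\ degree_constrained E f g.

Definition size_characterization (alpha beta : nat) : Prop :=
  feasibility_condition ->
  [/\ exists E : {set S * T}, realization E,
      (exists E : {set S * T}, realization E /\ (alpha <= #|E|)%N)
        <-> lower_condition alpha,
      (exists E : {set S * T}, realization E /\ (#|E| <= beta)%N)
        <-> upper_condition beta &
      (exists E : {set S * T}, realization E /\ (alpha <= #|E| <= beta)%N)
        <-> lower_condition alpha /\ upper_condition beta].

End Conditions.

Definition any_subpartition (T : finType)
  (Y : {set T}) (P : {set {set T}}) : bool := true.

Definition at_most_one_member (T : finType)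
  (Y : {set T}) (P : {set {set T}}) : bool := (#|P| <= 1)%N.

Definition empty_or_whole (T : finType)
  (Y : {set T}) (P : {set {set T}}) : bool := (P == set0) || (P == [set ~: Y]).

(* Main.v *)
Require Import Defs.
From mathcomp Require Import all_boot all_order all_algebra.
From mathcomp Require Import constructive_ereal.
From mathcomp Require Import zify.

(* The edge set is built node by node of S, as neighbourhoods N s in T, so that a
   graph covers p iff p(W) <= #{s | N s meets W}. For a level j put
   hull p j = max sum_(W in P) (p W - j) over subpartitions P; by choosing X with
   |X| = j, all conditions of the theorem become linear inequalities in hull p |X|.

   If only upper bounds g on the degrees in S are given, they can be met as soon
   as hull p |X| <= g(S - X) for all X. First, choosing the N s greedily yields a
   covering whose k smallest degrees have the least possible sum hull p (n - k);
   the uncrossing of packings that are optimal at different levels provides the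
   elements to choose. Then edges are moved from nodes of high degree to nodes of
   low degree, which never destroys the covering when chosen well, until g is met.

   Lower bounds on the degrees in T are values of p on singletons, and raising such
   values keeps p positively intersecting supermodular. Writing p^ for p with all
   singletons raised to g_T, the upper bounds g_T amount to
   m(X) + hull p^ |X| <= g_T(T) for the degrees m in S. These are constraints on m
   that depend on cardinalities only, and since hull p^ - hull p is nonincreasing
   they define, for a fixed number gamma of edges, a symmetric polymatroid, in which
   a point m of the box [f_S, g_S] exists. Finally the singletons are raised until
   their values add up to gamma, which turns all inequalities on degrees into
   equalities. *)

Set Implicit Arguments.
Unset Strict Implicit.
Unset Printing Implicit Defensive.

Import Order.TTheory GRing.Theory Num.Theory.
Local Open Scope ring_scope.

(** * Packings and uncrossing *)

Section Packings.
Variable T : finType.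
Implicit Types (p : {set T} -> int) (P Q C : {set {set T}}) (A B W : {set T}).
Implicit Types (i j : nat).

Definition packing P : bool := trivIset P && (set0 \notin P).

Lemma packingP P :
  reflect ((forall A B x, A \in P -> B \in P -> x \in A -> x \in B -> A = B)
           /\ set0 \notin P)
          (packing P).
Proof.
apply: (iffP andP) => -[triP nP0]; split=> //.
  move=> A B x PA PB Ax Bx; apply/eqP/negPn/negP => neAB.
  have /(_ A B PA PB neAB) := trivIsetP triP.
  by move/disjoint_setI0/setP/(_ x); rewrite !inE Ax Bx.
apply/trivIsetP => A B PA PB neAB; rewrite -setI_eq0; apply/set0Pn => -[x].
by rewrite inE => /andP[Ax Bx]; rewrite (triP A B x) ?eqxx in neAB.
Qed.

Lemma packing0 : packing set0.
Proof. by apply/packingP; split=> [A B x|]; rewrite inE. Qed.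

Lemma packing1 A : A != set0 -> packing [set A].
Proof.
move=> nA0; apply/packingP; split=> [B C x|]; rewrite !inE; last by rewrite eq_sym.
by move=> /eqP-> /eqP->.
Qed.

Lemma packingS P Q : P \subset Q -> packing Q -> packing P.
Proof.
move=> /subsetP sPQ /packingP[Q1 Q2]; apply/packingP; split.
  by move=> A B x PA PB; apply: Q1; apply: sPQ.
by apply: contra Q2 => /sPQ.
Qed.

Lemma packingU P Q :
  packing P -> packing Q -> [disjoint cover P & cover Q] -> packing (P :|: Q).
Proof.
move=> /andP[P1 P2] /andP[Q1 Q2] dPQ; apply/andP; split.
  by apply: trivIsetU.
by rewrite inE negb_or P2.
Qed.

Lemma mem_packing P A : packing P -> A \in P -> A != set0.
Proof. by case/andP=> _ nP0 PA; apply: contraNneq nP0 => <-. Qed.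

Lemma in_cover P A x : A \in P -> x \in A -> x \in cover P.
Proof. by move=> PA Ax; apply/bigcupP; exists A. Qed.

Lemma packing_disjoint P Q :
  packing P -> [disjoint cover P & cover Q] -> [disjoint P & Q].
Proof.
move=> pP dPQ; rewrite -setI_eq0; apply/set0Pn => -[A].
rewrite inE => /andP[PA QA]; have /set0Pn[x Ax] := mem_packing pP PA.
by move/disjoint_setI0/setP/(_ x): dPQ; rewrite !inE !(in_cover _ Ax).
Qed.

Lemma packing_coverD P Q :
  packing P -> Q \subset P -> cover (P :\: Q) = cover P :\: cover Q.
Proof.
move=> /packingP[P1 _] /subsetP sQP; apply/setP => x; rewrite inE.
apply/bigcupP/andP => [[A /setDP[PA nQA] Ax]|[nQx /bigcupP[A PA Ax]]].
  split; last exact: in_cover Ax.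
  by apply: contra nQA => /bigcupP[B QB Bx]; rewrite (P1 A B x PA (sQP B QB) Ax Bx).
by exists A; rewrite // inE PA andbT; apply: contra nQx => QA; apply: in_cover Ax.
Qed.

(** The level [j] stands for |X|: with [j] = |X| this is the subpartition term of all the
    conditions. *)
Definition excess p j P : int := \sum_(W in P) (p W - j%:Z).

Lemma excessE p j P : excess p j P = \sum_(W in P) p W - (#|P| * j)%:Z.
Proof. by rewrite /excess sumrB sumr_const -mulr_natr natz PoszM mulrC. Qed.

Lemma excess0 p j : excess p j set0 = 0.
Proof. by rewrite /excess big_set0. Qed.

Lemma excess1 p j A : excess p j [set A] = p A - j%:Z.
Proof. by rewrite /excess big_set1. Qed.

Lemma excessU p j P Q :
  [disjoint P & Q] -> excess p j (P :|: Q) = excess p j P + excess p j Q.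
Proof.
move=> dPQ; rewrite /excess -bigU //=; apply: eq_bigl => W.
by rewrite !inE.
Qed.

Lemma excessD p j P Q :
  Q \subset P -> excess p j P = excess p j Q + excess p j (P :\: Q).
Proof. by move=> sQP; rewrite /excess (big_setID Q) /= (setIidPr sQP). Qed.

Lemma excessD1 p j P A :
  A \in P -> excess p j P = (p A - j%:Z) + excess p j (P :\ A).
Proof. by move=> PA; rewrite (excessD p j (Q := [set A])) ?sub1set // excess1. Qed.

Definition optimal p j P : Prop :=
  packing P /\ forall Q, packing Q -> excess p j Q <= excess p j P.

Lemma optimal_eq p j P Q :
  optimal p j P -> packing Q -> excess p j P <= excess p j Q -> optimal p j Q.
Proof.
by move=> [_ oP] pQ le_PQ; split=> // R /oP /le_trans; apply.
Qed.

Lemma optimal_sub p j P Q : Q \subset P ->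
  (forall A, A \in P -> A \notin Q -> p A <= j%:Z) ->
  optimal p j P -> optimal p j Q.
Proof.
move=> sQP leP oP; apply: (optimal_eq oP); first exact: packingS (proj1 oP).
rewrite (excessD p j sQP) gerDl; apply: sumr_le0 => A /setDP[PA nQA].
by have := leP A PA nQA; lia.
Qed.

Lemma pis_absorb p A B : pos_intersecting_supermodular p ->
  A :&: B != set0 -> 0 < p A -> 0 < p B \/ B \subset A ->
  p A + p B <= p (A :&: B) + p (A :|: B).
Proof.
move=> pis nAB0 A0 [B0|sBA]; first exact: pis.
by rewrite (setIidPr sBA) (setUidPl sBA) addrC.
Qed.

(** The members of [Q] are absorbed into [A] one at a time. By disjointness, the union built so far
    meets the next member [B] exactly in [A :&: B], so each step is one uncrossing as long as the
    union has positive value. Once this value is at most 0, its term can be discarded, which gives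
    the second alternative. [B0] is absorbed first, so that it belongs to the subfamily. *)
Lemma star_uncrossing p A B0 Q :
  pos_intersecting_supermodular p -> 0 < p A -> packing Q ->
  (forall B, B \in Q -> A :&: B != set0 /\ (0 < p B \/ B \subset A)) -> B0 \in Q ->
  p A + \sum_(B in Q) p B <= p (A :|: cover Q) + \sum_(B in Q) p (A :&: B) \/
  exists C, [/\ C \subset Q, B0 \in C &
    p A + \sum_(B in C) p B <= \sum_(B in C) p (A :&: B)].
Proof.
move=> pis A0 /packingP[triQ _] Qok QB0.
set dead := exists C, _.
suff : forall m C, #|C| = m.+1 -> C \subset Q -> B0 \in C ->
    p A + \sum_(B in C) p B <= p (A :|: cover C) + \sum_(B in C) p (A :&: B)
    /\ 0 < p (A :|: cover C) \/ dead.
  move=> /(_ #|Q|.-1 Q) []; rewrite ?prednK //; first by apply/card_gt0P; exists B0.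
    by case=> ? _; left.
  by right.
elim=> [|m IHm] C cardC sCQ CB0.
  have /eqP -> : C == [set B0] by rewrite eq_sym eqEcard sub1set CB0 cardC cards1.
  rewrite !big_set1 /cover big_set1; have [nAB okB] := Qok B0 QB0.
  have := pis_absorb pis nAB A0 okB.
  case: (ltP 0 (p (A :|: B0))) => [U0 le|U0 le]; first by left; split=> //; lia.
  by right; exists [set B0]; rewrite sub1set !inE !big_set1; split=> //; lia.
have /set0Pn[B /setD1P[neB CB]] : C :\ B0 != set0.
  by move: cardC; rewrite -card_gt0 (cardsD1 B0 C) CB0 add1n => -[->].
have [|||[le U0]|] := IHm (C :\ B); last by right.
- by move: cardC; rewrite (cardsD1 B C) CB add1n => -[->].
- exact: subset_trans (subsetDl _ _) sCQ.
- by rewrite !inE eq_sym neB.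
have QB : B \in Q by apply: (subsetP sCQ).
have [nAB okB] := Qok B QB.
have UB : (A :|: cover (C :\ B)) :&: B = A :&: B.
  apply/setP => x; rewrite !inE; case: (x \in A) => //=.
  apply/negbTE/negP => /andP[/bigcupP[D /setD1P[neD CD] Dx] Bx].
  by rewrite (triQ D B x) ?eqxx ?(subsetP sCQ) in neD.
have UUB : (A :|: cover (C :\ B)) :|: B = A :|: cover C.
  by rewrite -setUA; congr (_ :|: _); rewrite /cover [RHS](big_setD1 B) //= setUC.
have := @pis_absorb p (A :|: cover (C :\ B)) B pis; rewrite UB UUB => /(_ nAB U0) abs.
have {}abs : p (A :|: cover (C :\ B)) + p B <= p (A :&: B) + p (A :|: cover C).
  apply: abs; case: okB => [?|sBA]; [by left | right].
  exact: subset_trans sBA (subsetUl _ _).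
have sumC (F : {set T} -> int) :
    \sum_(D in C) F D = F B + \sum_(D in C :\ B) F D.
  by rewrite (big_setD1 B CB).
rewrite !sumC.
case: (ltP 0 (p (A :|: cover C))) => V0; first by left; split=> //; lia.
by right; exists C; split; rewrite // !sumC; lia.
Qed.

(** Level arithmetic for [exchange]: merging [b] members into one saves [b - 1] times the level,
    dropping them saves [b] times the level. *)
Lemma exchange_gain_union i j b : (j <= i)%N -> (0 < b)%N ->
  b%:Z * j%:Z - j%:Z <= b%:Z * i%:Z - i%:Z /\
  ((j < i)%N -> b%:Z * i%:Z - i%:Z <= b%:Z * j%:Z - j%:Z -> (b <= 1)%N).
Proof. by move=> leji b0; split; nia. Qed.

Lemma exchange_gain_drop i j b : (j <= i)%N -> (0 < b)%N ->
  b%:Z * j%:Z <= b%:Z * i%:Z /\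
  ((j < i)%N -> b%:Z * j%:Z < b%:Z * i%:Z).
Proof. by move=> leji b0; split; nia. Qed.

(* Replacing A by its traces on the members of C, and these members by their union
   with A, increases the total excess by at least (i - j)(|C| - 1). *)
Lemma exchange p i j P Q A B0 : pos_intersecting_supermodular p -> (j <= i)%N ->
  optimal p j P -> optimal p i Q -> A \in P -> 0 < p A -> B0 \in Q ->
  A :&: B0 != set0 -> (forall B, B \in Q -> 0 < p B \/ B \subset A) ->
  exists C, [/\ C \subset Q, B0 \in C,
    optimal p j ((P :\ A) :|: [set A :&: B | B in C]) &
    (j < i)%N -> C = [set B0]].
Proof.
move=> pis leji oP oQ PA A0 QB0 nAB0 Qok.
have [pP _] := oP; have [pQ _] := oQ.
have [triP _] := packingP _ pP; have [triQ _] := packingP _ pQ.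
set QA := [set B in Q | A :&: B != set0].
have sQA : QA \subset Q by apply/subsetP => B; rewrite inE => /andP[].
have QAB0 : B0 \in QA by rewrite inE QB0.
have swap C : C \subset QA ->
    packing ((P :\ A) :|: [set A :&: B | B in C]) /\
    excess p j ((P :\ A) :|: [set A :&: B | B in C]) =
    excess p j P - (p A - j%:Z) +
      (\sum_(B in C) p (A :&: B) - #|C|%:Z * j%:Z).
  move=> /subsetP sCQ.
  have injC : {in C &, injective (setI A)}.
    move=> B B' /sCQ; rewrite inE => /andP[QB /set0Pn[x ABx]] /sCQ.
    rewrite inE => /andP[QB' _] eqB; apply: (triQ B B' x) => //.
      by case/setIP: ABx.
    by move: ABx; rewrite eqB => /setIP[].
  have coverC : cover [set A :&: B | B in C] \subset A.
    by apply/bigcupsP => _ /imsetP[B _ ->]; apply: subsetIl.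
  have dis : [disjoint cover (P :\ A) & cover [set A :&: B | B in C]].
    rewrite packing_coverD ?sub1set // /cover big_set1.
    apply: disjointWr coverC _; rewrite -setI_eq0.
    by apply/eqP/setP => x; rewrite !inE; case: (x \in A); rewrite ?andbF.
  have pPA : packing (P :\ A) by apply: packingS pP; apply: subsetDl.
  split; last first.
    rewrite excessU; last exact: packing_disjoint dis.
    rewrite (excessD1 p j PA) [excess p j [set _ | _ in _]]excessE.
    by rewrite big_imset //= card_in_imset // PoszM [_ - j%:Z + _]addrC addrK.
  apply: packingU => //; apply/packingP; split.
    move=> _ _ x /imsetP[B /sCQ + ->] /imsetP[B' /sCQ + ->].
    rewrite !inE => /andP[QB _] /andP[QB' _] /andP[_ Bx] /andP[_ B'x].
    by rewrite (triQ B B' x).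
  by apply/imsetP => -[B /sCQ]; rewrite inE => /andP[_ /eqP + /esym].
have card1 C : C \subset QA -> B0 \in C -> (#|C| <= 1)%N -> C = [set B0].
  by move=> _ CB0 le1; apply/esym/eqP; rewrite eqEcard sub1set CB0 cards1.
have [|B|le|[C [sCQA CB0 le]]] := @star_uncrossing p A B0 QA pis A0 _ _ QAB0.
- exact: packingS pQ.
- by rewrite inE => /andP[/Qok ? ?].
(* First alternative: the members of [Q] meeting [A] are merged with [A]. Optimality of [Q] at level
   [i] then leaves the swapped packing optimal at level [j]. *)
- have [pP' exP'] := swap QA (subxx _).
  have pQD : packing (Q :\: QA) by apply: packingS pQ; apply: subsetDl.
  have dis : [disjoint cover [set A :|: cover QA] & cover (Q :\: QA)].
    rewrite -setI_eq0; apply/set0Pn => -[x]; rewrite /cover big_set1 inE.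
    rewrite inE -/(cover QA) => /andP[xU /bigcupP[B /setDP[QB nQAB] Bx]].
    case/orP: xU => [Ax|].
      by case/negP: nQAB; rewrite inE QB; apply/set0Pn; exists x; rewrite inE Ax.
    case/bigcupP=> B' QAB' B'x; case/negP: nQAB.
    by rewrite (triQ B B' x) // (subsetP sQA).
  have pQ' : packing ([set A :|: cover QA] :|: (Q :\: QA)).
    apply: packingU => //; apply: packing1.
    by have /set0Pn[x Ax] := mem_packing pP PA; apply/set0Pn; exists x; rewrite inE Ax.
  have := proj2 oQ _ pQ'; have := proj2 oP _ pP'; rewrite exP'.
  rewrite excessU; last first.
    apply: packing_disjoint dis; apply: packing1.
    by have /set0Pn[x Ax] := mem_packing pP PA; apply/set0Pn; exists x; rewrite inE Ax.
  rewrite excess1 (excessD p i sQA) (excessE p i QA) PoszM => leP leQ.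
  have card_gt0 : (0 < #|QA|)%N by apply/card_gt0P; exists B0.
  have [gain1 gain2] := exchange_gain_union leji card_gt0.
  exists QA; split=> //.
    apply: (optimal_eq oP) => //; rewrite exP'.
    by clear -le leP leQ gain1; lia.
  move=> ltji; apply: card1 => //; apply: gain2 => //.
  by clear -le leP leQ; lia.
(* Second alternative: the members in [C] are removed from [Q] outright. For [j < i] the strict gain
   contradicts optimality, so the last claim holds vacuously. *)
have [pP' exP'] := swap C sCQA.
have sCQ := subset_trans sCQA sQA.
have := proj2 oQ _ (packingS (subsetDl Q C) pQ); have := proj2 oP _ pP'; rewrite exP'.
rewrite (excessD p i sCQ) (excessE p i C) PoszM => leP leQ.
have card_gt0 : (0 < #|C|)%N by apply/card_gt0P; exists B0.
have [gain1 gain2] := exchange_gain_drop leji card_gt0.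
exists C; split=> //.
  apply: (optimal_eq oP) => //; rewrite exP'.
  by clear -le leP leQ gain1; lia.
by move=> /gain2; clear -le leP leQ; lia.
Qed.

End Packings.

(** * Levels *)

Section Hull.
Variable T : finType.
Implicit Types (p : {set T} -> int) (P Q C : {set {set T}}) (A B W : {set T}).
Implicit Types (i j : nat) (t u : T).

Definition hull p j : int :=
  excess p j [arg max_(P > set0 | packing P) excess p j P]%O.

Lemma hull_optimal p j : exists P, optimal p j P /\ excess p j P = hull p j.
Proof.
rewrite /hull; case: arg_maxP => [|P pP maxP]; first exact: packing0.
by exists P.
Qed.

Lemma hull_ge p j P : packing P -> excess p j P <= hull p j.
Proof. by have [Q [[_ oQ] <-]] := hull_optimal p j; apply: oQ. Qed.

Lemma optimalE p j P : optimal p j P <-> packing P /\ excess p j P = hull p j.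
Proof.
split=> [[pP oP]|[pP eqP]]; split=> //.
  apply/le_anti; rewrite hull_ge //=.
  by have [Q [[pQ _] <-]] := hull_optimal p j; apply: oP.
by move=> Q /hull_ge; rewrite eqP.
Qed.

Lemma hull_le p j (m : int) :
  (forall P, packing P -> excess p j P <= m) -> hull p j <= m.
Proof. by have [P [[pP _] <-]] := hull_optimal p j; apply. Qed.

Lemma hull_ge0 p j : 0 <= hull p j.
Proof. by rewrite -(excess0 p j) hull_ge ?packing0. Qed.

Lemma hull_ge1 p j A : A != set0 -> p A - j%:Z <= hull p j.
Proof. by move=> nA0; rewrite -excess1 hull_ge ?packing1. Qed.

Lemma eq_hull p q j : p =1 q -> hull p j = hull q j.
Proof.
move=> eqpq; have eqex P : excess p j P = excess q j P.
  by apply: eq_bigr => W _; rewrite eqpq.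
by apply/le_anti/andP; split; apply: hull_le => P pP; rewrite (eqex, =^~ eqex) hull_ge.
Qed.

(** The excess of a fixed packing is affine in the level, with slope minus its number of members. Of
    two packings optimal at [b] and [c], the one with more members is evaluated at the lowest level
    [a], the other at [d]. *)
Lemma hull_convex p a b c d : (a <= b)%N -> (a <= c)%N -> (a + d = b + c)%N ->
  hull p b + hull p c <= hull p a + hull p d.
Proof.
move=> leab leac eqs.
have [P [[pP _] <-]] := hull_optimal p b; have [Q [[pQ _] <-]] := hull_optimal p c.
have [lePQ|ltPQ] := leqP #|Q| #|P|.
  have := hull_ge p a pP; have := hull_ge p d pQ; rewrite !excessE; nia.
have := hull_ge p a pQ; have := hull_ge p d pP; rewrite !excessE; nia.
Qed.

(** The singleton of [t] has as many neighbours as the degree of [t], so raising its value tightens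
    a lower bound on that degree. *)
Definition raise (c : T -> nat) p W : int :=
  p W + \sum_(t | W == [set t]) (c t)%:Z.

Lemma raise_set1 c p t : raise c p [set t] = p [set t] + (c t)%:Z.
Proof.
rewrite /raise (big_pred1 t) // => u /=.
by rewrite (inj_eq set1_inj) eq_sym.
Qed.

Lemma raise_id c p W : #|W| != 1%N -> raise c p W = p W.
Proof.
move=> W1; rewrite /raise big_pred0 ?addr0 // => t.
by apply: contraNF W1 => /eqP->; rewrite cards1.
Qed.

Lemma le_raise c p W : p W <= raise c p W.
Proof. by rewrite /raise lerDl sumr_ge0. Qed.

Lemma raiseD c d p W :
  raise (fun t => (c t + d t)%N) p W = raise c (raise d p) W.
Proof.
rewrite /raise -addrA; congr (_ + _); rewrite -big_split /=.
by apply: eq_bigr => t _; rewrite PoszD addrC.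
Qed.

(** A singleton meeting another set lies inside it, so the inequality at such a pair is an identity;
    for other pairs the left-hand side is not raised. *)
Lemma pis_raise c p : pos_intersecting_supermodular p ->
  pos_intersecting_supermodular (raise c p).
Proof.
move=> pis X Y nXY X0 Y0; rewrite /supermodular_at.
have sing t Z : Z :&: [set t] != set0 -> [set t] \subset Z.
  by case/set0Pn=> u; rewrite !inE sub1set => /andP[+ /eqP<-].
have [/cards1P[t eqX]|X1] := boolP (#|X| == 1%N).
  move: nXY; rewrite eqX setIC => /sing sYt.
  by rewrite (setIidPr sYt) (setUidPr sYt).
have [/cards1P[t eqY]|Y1] := boolP (#|Y| == 1%N).
  move: nXY; rewrite eqY => /sing sXt.
  by rewrite (setIidPr sXt) (setUidPl sXt) addrC.
move: X0 Y0; rewrite (raise_id c p X1) (raise_id c p Y1) => X0 Y0.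
by apply: le_trans (pis _ _ nXY X0 Y0) _; apply: lerD; apply: le_raise.
Qed.

Lemma excess_raise c p j P : excess (raise c p) j P =
  excess p j P + \sum_(t | [set t] \in P) (c t)%:Z.
Proof.
rewrite !excessE addrAC; congr (_ - _); rewrite big_split /=; congr (_ + _).
rewrite (exchange_big_dep xpredT) //= [RHS]big_mkcond /=.
apply: eq_bigr => t _; case: ifP => Pt.
  by rewrite (big_pred1 [set t]) // => W /=; case: eqP => [->|]; rewrite ?Pt ?andbF.
by rewrite big_pred0 // => W; case: eqP => [->|]; rewrite ?Pt ?andbF.
Qed.

(** Carries the singleton of [t] down to a lower level. If [t] lies in a larger member of [P],
    [exchange] cuts that member into traces, one of them the singleton. If [t] is uncovered, its
    singleton has value at least [i] by optimality of [Q] and can be added. *)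
Lemma single_swap p i j P Q t : pos_intersecting_supermodular p -> (j <= i)%N ->
  optimal p j P -> optimal p i Q -> [set t] \in Q ->
  exists P', [/\ optimal p j P', [set t] \in P' &
                 forall u, [set u] \in P -> [set u] \in P'].
Proof.
move=> pis leji oP oQ Qt.
(* [exchange] asks for positive values, so other members are dropped; singletons stay in [P1]
   whatever their value, because they have to survive. *)
pose P1 := [set W in P | (0 < p W) || (#|W| == 1)%N].
have oP1 : optimal p j P1.
  apply: optimal_sub oP => [|A PA]; first by apply/subsetP => W; rewrite inE => /andP[].
  by rewrite inE PA /= negb_or -leNgt => /andP[pA _]; lia.
have P1sing u : [set u] \in P -> [set u] \in P1 by rewrite inE cards1 orbT andbT.
pose Q1 := [set W in Q | (0 < p W) || (W == [set t])].
have oQ1 : optimal p i Q1.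
  apply: optimal_sub oQ => [|A QA]; first by apply/subsetP => W; rewrite inE => /andP[].
  by rewrite inE QA /= negb_or -leNgt => /andP[pA _]; lia.
have Q1t : [set t] \in Q1 by rewrite inE Qt eqxx orbT.
have [P1t|nP1t] := boolP ([set t] \in P1); first by exists P1.
have [/bigcupP[A P1A At]|ntP1] := boolP (t \in cover P1).
  have A1 : #|A| != 1%N.
    apply: contra nP1t => /cards1P[u eqA].
    by move: At P1A; rewrite eqA inE => /eqP->.
  have A0 : 0 < p A by move: P1A; rewrite inE (negPf A1) orbF => /andP[].
  have stA : [set t] \subset A by rewrite sub1set.
  have nAt : A :&: [set t] != set0.
    by rewrite (setIidPr stA); apply/set0Pn; exists t; rewrite inE.
  have [B|C [sCQ Ct oP' _]] := exchange pis leji oP1 oQ1 P1A A0 Q1t nAt.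
    by rewrite inE => /andP[_ /orP[|/eqP->]]; [left|right].
  exists ((P1 :\ A) :|: [set A :&: B | B in C]); split=> //.
    by rewrite inE; apply/orP; right; apply/imsetP; exists [set t]; rewrite ?(setIidPr stA).
  move=> u /P1sing P1u; rewrite in_setU in_setD1 P1u andbT; apply/orP; left.
  by apply: contraNneq A1 => <-; rewrite cards1.
have [pQ1 oQ1'] := oQ1; have [pP1 _] := oP1.
have := oQ1' _ (packingS (subsetDl Q1 [set [set t]]) pQ1).
rewrite (excessD1 p i Q1t) lerDr => pt.
have dis : [disjoint cover [set [set t]] & cover P1].
  by rewrite /cover big_set1 disjoints1.
have p1t : packing [set [set t]].
  by apply: packing1; apply/set0Pn; exists t; rewrite inE.
exists ([set [set t]] :|: P1); split.
- apply: (optimal_eq oP1); first exact: packingU.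
  rewrite excessU; last exact: packing_disjoint dis.
  by rewrite excess1 lerDr; clear -pt leji; lia.
- by rewrite !inE eqxx.
- by move=> u /P1sing P1u; rewrite inE P1u orbT.
Qed.

(** A unit raise of one singleton increases the hull at each level by 0 or 1. If it increases at
    level [j.+1], some optimal packing there contains the singleton, and [single_swap] brings it
    down to level [j]. *)
Lemma hull_raise1 p t j : pos_intersecting_supermodular p ->
  hull (raise (fun u => u == t) p) j.+1 + hull p j <=
  hull (raise (fun u => u == t) p) j + hull p j.+1.
Proof.
move=> pis; set q := raise _ p.
have exq i P : excess q i P = excess p i P + ([set t] \in P)%:Z.
  rewrite excess_raise; congr (_ + _); rewrite big_mkcond (bigD1 t) //= eqxx.
  rewrite big1 ?addr0 => [|u /negPf->]; first by case: ifP.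
  by case: ifP.
have lepq i : hull p i <= hull q i.
  by apply: hull_le => P pP; apply: le_trans (hull_ge q i pP); rewrite exq; lia.
have [Q [[pQ _] exQ]] := hull_optimal q j.+1.
have leQ := hull_ge p j.+1 pQ; have := lepq j.
rewrite -exQ exq; case: (boolP (_ \in Q)) => /= Qt; last by lia.
have [exQp|] := eqVneq (excess p j.+1 Q) (hull p j.+1); last by lia.
have [P [oP exP]] := hull_optimal p j.
have [|P' [/optimalE[pP' exP'] P't _]] := single_swap pis (leqnSn j) oP _ Qt.
  exact/optimalE.
by have := hull_ge q j pP'; rewrite exq P't exP' => /=; lia.
Qed.

(** The raise is decomposed into unit raises, and the interval of levels into unit steps. *)
Lemma hull_raise p c i j : pos_intersecting_supermodular p -> (i <= j)%N ->
  hull (raise c p) j + hull p i <= hull (raise c p) i + hull p j.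
Proof.
move=> pis leij; rewrite -(subnK leij); elim: (j - i)%N => [|k IHk].
  by rewrite addrC.
suff : hull (raise c p) (k + i).+1 + hull p (k + i)%N <=
       hull (raise c p) (k + i)%N + hull p (k + i).+1 by rewrite addSn; lia.
move: (k + i)%N => {IHk leij} l.
have [m] := ubnP (\sum_t c t)%N; elim: m c => // m IHm c ltc.
have [/forallP c0|/forallPn[t ct]] := boolP [forall t, c t == 0%N].
  have eq_p : raise c p =1 p.
    by move=> W; rewrite /raise big1 ?addr0 // => t _; rewrite (eqP (c0 t)).
  by rewrite !(eq_hull _ eq_p) addrC.
pose c' u := (c u - (u == t))%N.
have eq_c : raise c p =1 raise (fun u => u == t) (raise c' p).
  move=> W; rewrite -raiseD; congr (_ + _); apply: eq_bigr => u _; congr Posz.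
  by rewrite /c'; case: eqP => [->|]; lia.
have ltc' : (\sum_u c' u < m)%N.
  rewrite -ltnS; apply: leq_trans ltc; rewrite ltnS (bigD1 t) //= [X in (_ < X)%N](bigD1 t) //=.
  rewrite -addSn leq_add // /c' ?eqxx; first by lia.
  by apply: leq_sum => u /negPf->; rewrite subn0.
have := IHm c' ltc'; have := hull_raise1 t l (pis_raise (c := c') pis).
by rewrite !(eq_hull _ eq_c); lia.
Qed.

(** A smallest cover forces all members above the level and makes the traces produced by [exchange]
    fill the set that they replace. *)
Definition min_optimal p j P :=
  optimal p j P /\ forall Q, optimal p j Q -> (#|cover P| <= #|cover Q|)%N.

Lemma min_optimal_exists p j : exists P, min_optimal p j P.
Proof.
have [P0 [/optimalE[pP0 exP0] _]] := hull_optimal p j.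
have P00 : packing P0 && (excess p j P0 == hull p j) by rewrite pP0 exP0 eqxx.
case: (@arg_minnP _ P0 (fun P => packing P && (excess p j P == hull p j))
         (fun P => #|cover P|) P00) => P /andP[pP /eqP exP] minP.
exists P; split; first exact/optimalE.
by move=> Q /optimalE[pQ exQ]; apply: minP; rewrite pQ exQ eqxx.
Qed.

Lemma min_optimal_gt p j P A : min_optimal p j P -> A \in P -> j%:Z < p A.
Proof.
move=> [oP minP] PA; rewrite ltNge; apply/negP => leA.
have pP := proj1 oP.
have oPA : optimal p j (P :\ A).
  apply: optimal_sub oP => [|B PB]; first exact: subsetDl.
  by rewrite !inE PB andbT negbK => /eqP->.
have := minP _ oPA; rewrite packing_coverD ?sub1set // [cover [set A]]/cover big_set1.
move=> le.
have /set0Pn[x Ax] := mem_packing pP PA.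
have : (#|cover P :\: A| < #|cover P|)%N.
  apply: proper_card; apply/properP; split; first exact: subsetDl.
  by exists x; rewrite ?inE ?Ax //; apply: in_cover Ax.
by rewrite ltnNge le.
Qed.

(** [exchange] replaces [A] by traces on members of [Q]; if these missed a point of [A], the new
    optimal packing would cover less than [P]. For [j < i] the only trace is the one on [B]. *)
Lemma min_optimal_trace p i j P Q A B : pos_intersecting_supermodular p ->
  (j <= i)%N -> min_optimal p j P -> optimal p i Q ->
  (forall W, W \in Q -> i%:Z < p W) -> A \in P -> B \in Q -> A :&: B != set0 ->
  A \subset cover Q /\ ((j < i)%N -> A \subset B).
Proof.
move=> pis leji mP oQ Qgt PA QB nAB; have [oP minP] := mP.
have A0 : 0 < p A by have := min_optimal_gt mP PA; lia.
have [W QW|C [sCQ CB oP' C1]] := exchange pis leji oP oQ PA A0 QB nAB.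
  by left; have := Qgt W QW; lia.
have sAC : A \subset cover C.
  apply/subsetP => x Ax; apply: contraTT (minP _ oP') => nCx.
  rewrite -ltnNge; apply: proper_card; apply/properP; split.
    apply/subsetP => y /bigcupP[W + Wy]; rewrite in_setU => /orP[|].
      by case/setD1P=> _ PW; apply: in_cover Wy.
    case/imsetP=> D _ eqW; move: Wy; rewrite eqW inE => /andP[Ay _].
    exact: in_cover Ay.
  exists x; first exact: in_cover Ax.
  apply/bigcupP => -[W + Wx]; rewrite in_setU => /orP[/setD1P[neW PW]|].
    have [triP _] := packingP _ (proj1 oP).
    by rewrite (triP W A x) ?eqxx in neW.
  case/imsetP=> D CD eqW; case/negP: nCx; apply: in_cover CD _.
  by move: Wx; rewrite eqW inE => /andP[].
split.
  apply: subset_trans sAC _; apply/bigcupsP => W CW.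
  by apply: (bigcup_sup W); apply: (subsetP sCQ).
by move=> /C1 eqC; move: sAC; rewrite eqC /cover big_set1.
Qed.

Lemma optimal_meets p j P B : optimal p j P -> B != set0 -> j%:Z < p B ->
  exists2 A, A \in P & A :&: B != set0.
Proof.
move=> [pP oP] nB0 ltB.
have [/exists_inP[A PA nAB]|noA] := boolP [exists A in P, A :&: B != set0].
  by exists A.
have dis : [disjoint cover [set B] & cover P].
  rewrite -setI_eq0; apply/set0Pn => -[x]; rewrite /cover big_set1 inE.
  case/andP=> Bx /bigcupP[A PA Ax]; case/exists_inP: noA; exists A => //.
  by apply/set0Pn; exists x; rewrite inE Ax.
have := oP _ (packingU (packing1 nB0) pP dis).
rewrite excessU ?excess1; last by apply: packing_disjoint dis; apply: packing1.
by lia.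
Qed.

(* Minimally covering optimal packings at successive levels refine each other
   from the top level down, and a point of the last member lies in all of them. *)
Lemma common_point p n A0 : pos_intersecting_supermodular p ->
  A0 != set0 -> n%:Z < p A0 ->
  exists a, forall j Q, (j <= n)%N -> optimal p j Q ->
    (forall W, W \in Q -> j%:Z < p W) -> a \in cover Q.
Proof.
move=> pis nA00 ltA0.
have [F F_min] : exists F, forall j, (j <= n)%N -> min_optimal p j (F j).
  have [F F_min] := fin_all_exists (fun j : 'I_n.+1 => min_optimal_exists p j).
  by exists (fun j => F (inord j)) => j lejn; have := F_min (inord j); rewrite inordK.
have lek k : (n - k <= n)%N by apply: leq_subr.
(* Descending from level [n], a member is found inside the one chosen a level above, hence inside
   the covers of all higher levels. *)
have : forall k, (k <= n)%N -> exists2 B, B \in F (n - k)%N &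
    forall l, (n - k <= l <= n)%N -> B \subset cover (F l).
  elim=> [_|k IHk ltkn].
    have [B FB _] := optimal_meets (proj1 (F_min n (leqnn n))) nA00 ltA0.
    exists B; rewrite ?subn0 // => l; rewrite -eqn_leq => /eqP <-.
    exact: (bigcup_sup B).
  have [B FB sB] := IHk (ltnW ltkn).
  have ltB : (n - k.+1)%N%:Z < p B by have := min_optimal_gt (F_min _ (lek _)) FB; lia.
  have nB0 := mem_packing (proj1 (proj1 (F_min _ (lek _)))) FB.
  have [A FA nAB] := optimal_meets (proj1 (F_min _ (lek k.+1))) nB0 ltB.
  exists A => // l /andP[lel leln].
  have [eql|nel] := eqVneq l (n - k.+1)%N; first by rewrite eql; apply: (bigcup_sup A).
  apply: subset_trans (sB l _); last by lia.
  have oFk := proj1 (F_min _ (lek k)).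
  have [|W FW|_ -> //] := min_optimal_trace pis _ (F_min _ (lek k.+1)) oFk _ FA FB nAB.
  - by lia.
  - exact: min_optimal_gt (F_min _ (lek k)) FW.
  - by lia.
move=> /(_ n (leqnn n)) [B FB sB].
have /set0Pn[a Ba] := mem_packing (proj1 (proj1 (F_min _ (lek _)))) FB.
exists a => j Q lejn oQ Qgt.
have /bigcupP[A FA Aa] : a \in cover (F j) by apply: (subsetP (sB j _)); rewrite ?subnn.
have nA0 : A != set0 by apply/set0Pn; exists a.
have [C QC nCA] := optimal_meets oQ nA0 (min_optimal_gt (F_min _ lejn) FA).
rewrite setIC in nCA.
have [sAQ _] := min_optimal_trace pis (leqnn j) (F_min j lejn) oQ Qgt FA QC nCA.
exact: (subsetP sAQ).
Qed.

End Hull.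

(** * Greedy neighbourhoods and balancing *)

Section Greedy.
Variable T : finType.
Implicit Types (p : {set T} -> int) (P Q : {set {set T}}) (A B N W X Y : {set T}).
Implicit Types (i j n k : nat) (a t : T).

(** A number rather than a truth value, so that the sum of [hit (N s) W] over [s] counts the
    neighbours of [W]. *)
Definition hit N W : nat := N :&: W != set0.

Lemma hit_le1 N W : (hit N W <= 1)%N.
Proof. exact: leq_b1. Qed.

Lemma hit0 N : hit N set0 = 0%N.
Proof. by rewrite /hit setI0 eqxx. Qed.

Lemma set0_hit W : hit set0 W = 0%N.
Proof. by rewrite /hit set0I eqxx. Qed.

Lemma hit1 N W t : t \in N -> t \in W -> hit N W = 1%N.
Proof.
by move=> Nt Wt; rewrite /hit; case: set0Pn => // -[]; exists t; rewrite inE Nt.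
Qed.

Lemma hit_gt0 N W : (0 < hit N W)%N -> exists2 t, t \in N & t \in W.
Proof.
by rewrite lt0b => /set0Pn[t]; rewrite inE => /andP[Nt Wt]; exists t.
Qed.

Lemma hitS N N' W W' : N \subset N' -> W \subset W' -> (hit N W <= hit N' W')%N.
Proof.
move=> sN sW; case: (posnP (hit N W)) => [->//|/hit_gt0[t Nt Wt]].
by rewrite (hit1 (subsetP sN _ Nt) (subsetP sW _ Wt)) hit_le1.
Qed.

Lemma hit_submod N X Y :
  (hit N (X :&: Y) + hit N (X :|: Y) <= hit N X + hit N Y)%N.
Proof.
have sI : (hit N (X :&: Y) <= hit N X)%N by rewrite hitS ?subsetIl.
have sI' : (hit N (X :&: Y) <= hit N Y)%N by rewrite hitS ?subsetIr.
have := hit_le1 N (X :|: Y); case: (posnP (hit N (X :|: Y))) => [->|]; first by lia.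
move=> /hit_gt0[t Nt]; rewrite inE => /orP[Xt|Yt].
  by have := hit1 Nt Xt; lia.
by have := hit1 Nt Yt; lia.
Qed.

Definition residual N p W : int := p W - (hit N W)%:Z.

Lemma pis_residual N p : pos_intersecting_supermodular p ->
  pos_intersecting_supermodular (residual N p).
Proof.
move=> pis X Y nXY X0 Y0; rewrite /supermodular_at /residual.
have := hit_submod N X Y; have := pis X Y nXY; rewrite /supermodular_at.
by rewrite /residual in X0 Y0; lia.
Qed.

(** The element to add is a point common to all optimal packings of the residual function at levels
    up to [n], once members of value at most the level are removed. It lowers the residual of one
    member of each such packing. *)
Lemma greedy_step p N A n : pos_intersecting_supermodular p ->
  (forall W, p W <= n.+1%:Z) -> A != set0 -> n%:Z < residual N p A ->
  exists2 a, a \notin N & forall j, (j <= n)%N ->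
    hull (residual (a |: N) p) j + 1 <= hull (residual N p) j.
Proof.
move=> pis lep nA0 ltA; set r := residual N p.
have pisr : pos_intersecting_supermodular r by apply: pis_residual.
have [a ain] := common_point pisr nA0 ltA.
have [P mP] := min_optimal_exists r n; have [oP _] := mP.
have /bigcupP[A0 PA0 A0a] : a \in cover P.
  by apply: (ain n) => // W PW; apply: min_optimal_gt mP PW.
have := min_optimal_gt mP PA0; rewrite /r /residual => ltA0.
(* The residual of [A0] exceeds [n] while [p A0] is at most [n.+1], so [N] misses [A0] and [p A0]
   attains the bound. *)
have NA0 t : t \in N -> t \in A0 -> False.
  by move=> Nt A0t; have := lep A0; have := hit1 Nt A0t; lia.
have pA0 : p A0 = n.+1%:Z by have := lep A0; lia.
have NaN : a \notin N by apply/negP => /NA0; apply.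
exists a => // j lejn.
have le_r W : residual (a |: N) p W <= r W.
  by have := hitS (subsetUr [set a] N) (subxx W); rewrite /r /residual; lia.
suff le Q : packing Q -> excess (residual (a |: N) p) j Q <= hull r j - 1.
  by rewrite -lerBrDr; apply: hull_le.
move=> pQ; have leex R : excess (residual (a |: N) p) j R <= excess r j R.
  by apply: ler_sum => W _; rewrite lerD2r.
have [exQ|] := eqVneq (excess r j Q) (hull r j); last first.
  by have := hull_ge r j pQ; have := leex Q; lia.
have oQ : optimal r j Q by apply/optimalE.
pose Q1 := [set W in Q | j%:Z < r W].
have sQ1 : Q1 \subset Q by apply/subsetP => W; rewrite inE => /andP[].
have oQ1 : optimal r j Q1.
  by apply: optimal_sub oQ => // W QW; rewrite inE QW /= -leNgt.
have /bigcupP[W Q1W Wa] : a \in cover Q1.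
  by apply: (ain j) => // W; rewrite inE => /andP[].
have QW := subsetP sQ1 W Q1W.
have rW : j%:Z < r W by move: Q1W; rewrite inE => /andP[].
have [NW|/hit_gt0[t Nt Wt]] := posnP (hit N W).
  rewrite -exQ !(excessD1 _ _ QW); have := leex (Q :\ W).
  have Na : a \in a |: N by rewrite !inE eqxx.
  have -> : residual (a |: N) p W = r W - 1.
    by rewrite /r /residual NW (hit1 Na Wa) subr0.
  move: (excess _ j _) (excess r j _) (r W) => x y z; clear; lia.
(* If [N] already meets [W], uncrossing [W] with [A0], whose value is maximal, shows that
   [W :&: A0], which [N] misses, has a larger residual than [W]; replacing [W] by it would improve
   [Q1]. *)
exfalso.
have nWA0 : W :&: A0 != set0 by apply/set0Pn; exists a; rewrite inE Wa.
have [pQ1 maxQ1] := oQ1.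
have hitW : hit N W = 1%N by apply: hit1 Nt Wt.
have rI : r (W :&: A0) = p (W :&: A0).
  rewrite /r /residual; have [->|/hit_gt0[u Nu]] := posnP (hit N (W :&: A0)).
    by rewrite subr0.
  by rewrite inE => /andP[_ /(NA0 u Nu)].
have lt_r : r W < r (W :&: A0).
  have := pis W A0 nWA0; have := lep (W :|: A0); rewrite rI /supermodular_at.
  by move: rW; rewrite /r /residual hitW pA0; clear; lia.
have dis : [disjoint cover [set W :&: A0] & cover (Q1 :\ W)].
  rewrite packing_coverD ?sub1set // /cover !big_set1 -setI_eq0.
  by apply/eqP/setP => x; rewrite !inE; case: (x \in W); rewrite ?andbF.
have pD : packing (Q1 :\ W) by apply: packingS pQ1; apply: subsetDl.
have := maxQ1 _ (packingU (packing1 nWA0) pD dis).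
rewrite excessU ?excess1; last by apply: packing_disjoint dis; apply: packing1.
by rewrite (excessD1 _ _ Q1W) !lerD2r leNgt lt_r.
Qed.

(** [N] is a largest set whose size is paid for by the drop of the hull at every level up to [n]; if
    some residual still exceeded [n], [greedy_step] would extend it. *)
Lemma greedy_set p n : pos_intersecting_supermodular p -> p set0 <= 0 ->
  (forall W, p W <= n.+1%:Z) ->
  exists N, (forall W, residual N p W <= n%:Z) /\
    forall j, (j <= n)%N -> hull (residual N p) j + #|N|%:Z <= hull p j.
Proof.
move=> pis p0 lep.
pose ok N := [forall j : 'I_n.+1, hull (residual N p) j + #|N|%:Z <= hull p j].
have ok0 : ok set0.
  apply/forallP => j; rewrite cards0 addr0 (@eq_hull _ _ p) // => W.
  by rewrite /residual set0_hit subr0.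
case: (@arg_maxnP _ set0 ok (fun N => #|N|) ok0) => N okN maxN.
have okNj j : (j <= n)%N -> hull (residual N p) j + #|N|%:Z <= hull p j.
  by move=> lejn; have := forallP okN (inord j); rewrite inordK.
exists N; split=> // A; rewrite leNgt; apply/negP => ltA.
have nA0 : A != set0.
  by apply: contraTneq ltA => ->; rewrite /residual hit0; lia.
have [a Na le] := greedy_step pis lep nA0 ltA.
have /maxN : ok (a |: N).
  apply/forallP => -[j /= ltj]; have := okNj j ltj; have := le j ltj.
  by rewrite cardsU1 Na; lia.
by rewrite /= cardsU1 Na; lia.
Qed.

(** Each set lowers the maximal demand by one, so [n] sets suffice. The prefix bound telescopes: at
    level [n - k], each of the first [k] sets is paid for by a drop of the hull. *)
Lemma greedy_family p n : pos_intersecting_supermodular p -> p set0 <= 0 ->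
  (forall W, p W <= n%:Z) ->
  exists N : nat -> {set T},
    (forall W, p W <= (\sum_(i < n) hit (N i) W)%N%:Z) /\
    forall k, (k <= n)%N -> (\sum_(i < k) #|N i|)%N%:Z <= hull p (n - k)%N.
Proof.
elim: n p => [|n IHn] p pis p0 lep.
  exists (fun _ => set0); split=> [W|k]; first by rewrite big_ord0.
  by rewrite leqn0 => /eqP->; rewrite big_ord0 hull_ge0.
have [N0 [leN0 hullN0]] := greedy_set pis p0 lep.
have [|N [coverN hullN]] := IHn _ (pis_residual (N := N0) pis) _ leN0.
  by rewrite /residual hit0 subr0.
pose N' i := if i is i'.+1 then N i' else N0.
have sumN' m (F : {set T} -> nat) :
    (\sum_(i < m.+1) F (N' i) = F N0 + \sum_(i < m) F (N i))%N.
  by rewrite big_ord_recl.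
exists N'; split=> [W|[|k] lekn].
- by rewrite (sumN' n (hit^~ W)); have := coverN W; rewrite /residual; lia.
- by rewrite big_ord0 hull_ge0.
rewrite (sumN' k (fun A => #|A|)) subSS; have := hullN k lekn.
by have := hullN0 (n - k)%N (leq_subr _ _); lia.
Qed.

End Greedy.

(** * Moving edges between nodes of S *)

Section Balancing.
Variables (T I : finType) (p : {set T} -> int).
Implicit Types (N : I -> {set T}) (W Y : {set T}) (t : T).
Hypothesis pis : pos_intersecting_supermodular p.

Definition covering N : Prop :=
  forall W, p W <= (\sum_i hit (N i) W)%N%:Z.

Definition move N a b t (i : I) : {set T} :=
  if i == a then N a :\ t else if i == b then t |: N b else N i.

(** The move can only lose at [a] and only gain at [b], so a set left short was tight, loses exactly
    one at [a] and gains nothing at [b]. *)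
Lemma move_blocked N a b t Y : a != b -> covering N -> t \in N a ->
  (\sum_i hit (move N a b t i) Y)%N%:Z < p Y ->
  [/\ p Y = (\sum_i hit (N i) Y)%N%:Z, t \in Y,
      forall u, u \in N a -> u \in Y -> u = t & exists2 u, u \in N b & u \in Y].
Proof.
move=> neab covN Nat; have := covN Y; have neba : b != a by rewrite eq_sym.
have sumab (F : I -> nat) :
    (\sum_i F i = F a + (F b + \sum_(i | (i != a) && (i != b)) F i))%N.
  by rewrite (bigD1 a) //= (bigD1 b).
rewrite !sumab {1 2}/move eqxx (negPf neba) eqxx.
rewrite [X in (_ + (_ + X))%N%:Z < _](eq_bigr (fun i => hit (N i) Y)); last first.
  by move=> i /andP[/negPf ia /negPf ib]; rewrite /move ia ib.
have := hitS (subsetUr [set t] (N b)) (subxx Y).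
have := hit_le1 (N a) Y; have := hit_le1 (t |: N b) Y.
set R := (\sum_(i | _) _)%N => le1 le2 le3 le4 le5.
have hitD : hit (N a :\ t) Y = 0%N by lia.
have hita : hit (N a) Y = 1%N by lia.
have eqY u : u \in N a -> u \in Y -> u = t.
  move=> Nau Yu; apply/eqP/negPn/negP => neu.
  by rewrite (hit1 (t := u)) // !inE neu in hitD.
have Yt : t \in Y.
  have [|u Nau Yu] := @hit_gt0 _ (N a) Y; first by rewrite hita.
  by rewrite -(eqY u).
have hitb : hit (t |: N b) Y = 1%N by apply: hit1 Yt; rewrite !inE eqxx.
split=> //; first by lia.
by apply: hit_gt0; lia.
Qed.

(* Sets blocking the transfer of two different elements are disjoint, and each
   contains an element of N b outside N a: there are too few of these. *)
Lemma transfer N a b : covering N -> (#|N b| < #|N a|)%N ->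
  exists t, [/\ t \in N a, t \notin N b & covering (move N a b t)].
Proof.
move=> covN ltba; have neab : a != b by apply: contraTneq ltba => ->; rewrite ltnn.
pose free t := [forall Y, p Y <= (\sum_i hit (move N a b t i) Y)%N%:Z].
have [/exists_inP[t]|blocked] := boolP [exists t in N a :\: N b, free t].
  by rewrite inE => /andP[? ?] /forallP; exists t.
(* A blocking set is chosen for every [t]; outside [N a :\: N b] the value is a dummy. *)
have [Y HY] : exists Y : T -> {set T}, forall t, t \in N a :\: N b ->
    (\sum_i hit (move N a b t i) (Y t))%N%:Z < p (Y t).
  apply: (@fin_all_exists T (fun _ => {set T}) (fun t Y => t \in N a :\: N b ->
    (\sum_i hit (move N a b t i) Y)%N%:Z < p Y)) => t.
  have [Dt|_] := boolP (t \in N a :\: N b); last by exists set0.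
  have : ~~ free t by apply: contra blocked => ?; apply/exists_inP; exists t.
  by case/forallPn=> Y; rewrite -ltNge; exists Y.
have D t : t \in N a :\: N b -> t \in N a /\ t \notin N b by case/setDP.
have [e He] : exists e : T -> T, forall t, t \in N a :\: N b ->
    e t \in N b /\ e t \in Y t.
  apply: (@fin_all_exists T (fun _ => T) (fun t u => t \in N a :\: N b ->
    u \in N b /\ u \in Y t)) => t.
  have [Dt|_] := boolP (t \in N a :\: N b); last by exists t.
  have [Nat _] := D t Dt.
  by have [_ _ _ [u Nbu Yu]] := move_blocked neab covN Nat (HY t Dt); exists u.
(* If [e t = e u] for different [t] and [u], the tight sets [Y t] and [Y u] meet and can be
   uncrossed. But [N a] meets both and misses their intersection, so the covering count is strictly
   submodular on this pair. *)
have inje : {in N a :\: N b &, injective e}.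
  move=> t u Dt Du eqe; apply/eqP/negPn/negP => netu.
  have [[Nat _] [Nau _]] := (D t Dt, D u Du).
  have [pt Yt Yat _] := move_blocked neab covN Nat (HY t Dt).
  have [pu Yu Yau _] := move_blocked neab covN Nau (HY u Du).
  have nI : Y t :&: Y u != set0.
    by apply/set0Pn; exists (e t); rewrite inE {2}eqe !(proj2 (He _ _)).
  have gt0 (Z : {set T}) v : v \in N a -> v \in Z -> (0 < \sum_i hit (N i) Z)%N.
    by move=> Nav Zv; rewrite (bigD1 a) //= (hit1 Nav Zv).
  have := pis nI; rewrite /supermodular_at pt pu !ltz_nat.
  move=> /(_ (gt0 _ _ Nat Yt) (gt0 _ _ Nau Yu)).
  apply/negP; rewrite -ltNge.
  apply: le_lt_trans (lerD (covN _) (covN _)) _.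
  rewrite -!PoszD ltz_nat -!big_split /= (bigD1 a) //= [X in (_ < X)%N](bigD1 a) //=.
  rewrite -addSn leq_add //; last by apply: leq_sum => i _; apply: hit_submod.
  rewrite (hit1 Nat Yt) (hit1 Nau Yu) addnC addn1.
  suff -> : hit (N a) (Y t :&: Y u) = 0%N by rewrite addn0 !ltnS hit_le1.
  apply/eqP; rewrite -leqn0 leqNgt; apply/negP => /hit_gt0[v Nav].
  rewrite inE => /andP[/(Yat _ Nav) eqvt /(Yau _ Nav) equ].
  by rewrite -eqvt -equ eqxx in netu.
have : (#|N a :\: N b| <= #|N b :\: N a|)%N.
  rewrite -(card_in_imset inje); apply: subset_leq_card.
  apply/subsetP => _ /imsetP[t Dt ->]; have [Nbe Ye] := He t Dt.
  have [Nat nNbt] := D t Dt; rewrite inE Nbe andbT.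
  have [_ _ Yat _] := move_blocked neab covN Nat (HY t Dt).
  by apply: contra nNbt => /Yat/(_ Ye) <-.
have := cardsID (N b) (N a); have := cardsID (N a) (N b); rewrite setIC.
by clear -ltba; lia.
Qed.

End Balancing.

(** Let [a] be the first index exceeding its bound. The prefix condition gives an earlier [b] below
    its bound, and monotonicity of [g] makes [N b] smaller than [N a], so [transfer] applies and the
    total overrun decreases. *)
Lemma balance (T : finType) (p : {set T} -> int) n (N : 'I_n -> {set T})
    (g : 'I_n -> nat) : pos_intersecting_supermodular p -> covering p N ->
  (forall i j : 'I_n, (i <= j)%N -> (g i <= g j)%N) ->
  (forall k, (\sum_(i < n | (i < k)%N) #|N i| <= \sum_(i < n | (i < k)%N) g i)%N) ->
  exists N' : 'I_n -> {set T}, covering p N' /\ forall i, (#|N' i| <= g i)%N.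
Proof.
move=> pis covN monog; have [m] := ubnP (\sum_i (#|N i| - g i))%N.
elim: m N covN => // m IHm N covN ltm prefix.
have [/forallP leg|/forallPn[i0]] := boolP [forall i, #|N i| <= g i]%N.
  by exists N.
rewrite -ltnNge => lti0.
case: (@arg_minnP _ i0 (fun i => (g i < #|N i|)%N) (fun i => i : nat) lti0) => a lta mina.
have leg (i : 'I_n) : (i < a)%N -> (#|N i| <= g i)%N.
  by move=> ltia; rewrite leqNgt; apply: contraTN ltia => /mina; rewrite -leqNgt.
have [/exists_inP[b ltbg ltba]|noB] :=
    boolP [exists (b : 'I_n | (#|N b| < g b)%N), (b < a)%N]; last first.
  have := prefix a.+1; rewrite leqNgt => /negP[].
  rewrite (bigD1 a) //= [X in (_ < X)%N](bigD1 a) //= -addSn leq_add //.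
  apply: leq_sum => i /andP[ltia neia]; rewrite leqNgt.
  apply: contra noB => ltig; apply/exists_inP; exists i => //.
  by rewrite ltn_neqAle neia -ltnS.
have lt_ba : (#|N b| < #|N a|)%N.
  by apply: leq_trans ltbg _; apply: leq_trans (monog _ _ (ltnW ltba)) (ltnW lta).
have [t [Nat nNbt covM]] := transfer pis covN lt_ba.
have neba : (b == a) = false by apply/negbTE; apply: contraTneq ltba => ->; rewrite ltnn.
have neab : (a == b) = false by rewrite eq_sym.
have cardM i : (#|move N a b t i| + (i == a) = #|N i| + (i == b))%N.
  rewrite /move; case: (eqVneq i a) => [->|_].
    by rewrite neab (cardsD1 t (N a)) Nat; lia.
  case: (eqVneq i b) => [->|_] //.
  by rewrite cardsU1 nNbt; lia.
apply: (IHm (move N a b t)) => //.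
  rewrite -ltnS; apply: leq_trans ltm; rewrite ltnS.
  rewrite (bigD1 a) //= [X in (_ < X)%N](bigD1 a) //= -addSn leq_add //.
    by have := cardM a; rewrite eqxx neab; clear -lta; lia.
  apply: leq_sum => i /negPf neia; have := cardM i; rewrite neia.
  by case: eqP => [->|_]; clear -ltbg; lia.
(* Prefixes without [a] consist of sets within their bounds, even after [N b] has grown; longer ones
   contain both [a] and [b] and keep their sums. *)
move=> k; have [leka|ltak] := leqP k a.
  apply: leq_sum => i ltik; have := cardM i; have := leg i (leq_trans ltik leka).
  case: (eqVneq i a) => [eqia|_]; first by move: ltik; rewrite eqia ltnNge leka.
  by case: (eqVneq i b) => [->|_]; clear -ltbg; lia.
have : (\sum_(i < n | (i < k)%N) (#|move N a b t i| + (i == a)) =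
        \sum_(i < n | (i < k)%N) (#|N i| + (i == b)))%N by apply: eq_bigr => i _.
rewrite !big_split /= => eqsum; have := prefix k.
have sum1 (c : 'I_n) : (c < k)%N -> (\sum_(i < n | (i < k)%N) (i == c) = 1)%N.
  move=> ltck; rewrite (bigD1 c) //= eqxx big1 // => i /andP[_ /negPf->] //.
move: eqsum; rewrite !sum1 //; last exact: ltn_trans ltba ltak.
by move=> /addIn ->.
Qed.

(** * Degree bounds *)

(** The nodes are ordered by increasing [g]. The hypothesis for the set of the last [n - l] nodes
    compares the greedy prefix sums with those of [g], as [balance] requires. *)
Lemma bounded_covering (S T : finType) (p : {set T} -> int) (g : S -> nat) :
  pos_intersecting_supermodular p -> p set0 <= 0 ->
  (forall X : {set S}, hull p #|X| <= (\sum_(s in ~: X) g s)%N%:Z) ->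
  exists N : S -> {set T}, covering p N /\ forall s, (#|N s| <= g s)%N.
Proof.
move=> pis p0 hullp; pose n := #|S|.
pose st := sort_tuple (relpre g leq) (enum_tuple S).
pose sigma (i : 'I_n) := tnth st i.
have inj_sigma : injective sigma.
  by apply/tuple_uniqP; rewrite /= sort_uniq enum_uniq.
have [rho sigmaK rhoK] : bijective sigma by apply: inj_card_bij; rewrite ?card_ord.
have mono (i j : 'I_n) : (i <= j)%N -> (g (sigma i) <= g (sigma j))%N.
  move=> leij; rewrite /sigma !(tnth_nth (sigma i)).
  apply: (@sorted_leq_nth _ (relpre g leq) _ _ (sigma i) st) => //.
  - by move=> x y z; apply: leq_trans.
  - by move=> x; apply: leqnn.
  - by apply: sort_sorted => x y; apply: leq_total.
  - by rewrite inE size_tuple.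
  - by rewrite inE size_tuple.
have lep W : p W <= n%:Z.
  have [->|nW0] := eqVneq W set0; first exact: le_trans p0 _.
  have := hullp setT; rewrite setCT big_set0 cardsT => hulln.
  by have := hull_ge1 p n nW0; rewrite -/n in hulln; lia.
have [N [covN prefix]] := greedy_family pis p0 lep.
have [|||N' [covN' leN']] := @balance _ p n (fun i => N i) (g \o sigma) pis.
- exact: covN.
- exact: mono.
- move=> k; pose l := minn k n.
  have eqkl (F : 'I_n -> nat) :
      (\sum_(i < n | (i < k)%N) F i = \sum_(i < n | (i < l)%N) F i)%N.
    by apply: eq_bigl => i; rewrite /l leq_min ltn_ord andbT.
  have leln : (l <= n)%N by rewrite geq_minr.
  rewrite !eqkl -(big_ord_widen n (fun i => #|N i|)) // -lez_nat.
  apply: le_trans (prefix l leln) _.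
  pose X := [set sigma i | i : 'I_n in [pred i : 'I_n | (l <= i)%N]].
  have cardX : #|X| = (n - l)%N.
    have cardl : #|[predC [pred i : 'I_n | (l <= i)%N]]| = l.
      rewrite -sum1_card (eq_bigl (fun i : 'I_n => (i < l)%N)) => [|i].
        by rewrite -(big_ord_widen n (fun _ => 1%N)) // sum_nat_const card_ord muln1.
      by rewrite !inE -ltnNge.
    have := cardC [pred i : 'I_n | (l <= i)%N].
    by rewrite card_imset // cardl card_ord => /(canRL (addnK _)).
  rewrite -cardX; apply: le_trans (hullp X) _; rewrite lez_nat.
  rewrite (reindex sigma) /=; last by exists rho => i _.
  rewrite (eq_bigl (fun i : 'I_n => (i < l)%N)) // => i.
  by rewrite inE mem_imset // inE -ltnNge.
exists (N' \o rho); split=> [W|s] /=; last by have := leN' (rho s); rewrite /= rhoK.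
have := covN' W; rewrite [X in _ <= X%:Z](reindex rho) //.
by exists sigma => i _.
Qed.

Lemma sum_setUI (S : finType) (F : S -> int) (X Z : {set S}) :
  \sum_(s in X :|: Z) F s + \sum_(s in X :&: Z) F s =
  \sum_(s in X) F s + \sum_(s in Z) F s.
Proof.
have ind Y : \sum_(s in Y) F s = \sum_s (if s \in Y then F s else 0) by exact: big_mkcond.
rewrite !ind -!big_split; apply: eq_bigr => s _; rewrite !inE.
by case: (s \in X); case: (s \in Z); rewrite /= ?addr0 ?add0r.
Qed.

Lemma sum_setC (S : finType) (F : S -> int) (X : {set S}) :
  \sum_s F s = \sum_(s in X) F s + \sum_(s in ~: X) F s.
Proof.
by rewrite (bigID [in X]) /=; congr (_ + _); apply: eq_bigl => s; rewrite inE.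
Qed.

Lemma sum_incr (S : finType) (F : S -> int) (X : {set S}) s :
  \sum_(u in X) (F u + (u == s)%:Z) = \sum_(u in X) F u + (s \in X)%:Z.
Proof.
rewrite big_split /=; congr (_ + _); rewrite big_mkcond (bigD1 s) //= eqxx.
rewrite big1 ?addr0 => [|u /negPf->]; first by case: ifP.
by case: ifP.
Qed.

(** [f] is raised by units while all constraints persist. When no raise is possible, every node
    below its upper bound lies in a tight set, and tight sets are closed under union; so [f] equals
    [g] outside a largest tight set, and the hypothesis on [gamma] at that set gives the total. *)
Lemma box_symmetric_polymatroid (S : finType) (f g : S -> int) (h : nat -> int)
    (gamma : int) :
  (forall X Z : {set S}, h #|X :|: Z| + h #|X :&: Z| <= h #|X| + h #|Z|) ->
  h 0%N <= 0 -> (forall s, f s <= g s) ->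
  (forall X : {set S}, \sum_(s in X) f s <= h #|X|) ->
  (forall X : {set S}, gamma <= h #|X| + \sum_(s in ~: X) g s) ->
  exists m : S -> int, [/\ forall s, f s <= m s <= g s,
    forall X : {set S}, \sum_(s in X) m s <= h #|X| & gamma <= \sum_s m s].
Proof.
move=> subm h0 + + geg; have [k] := ubnP (\sum_s absz (g s - f s))%N.
elim: k f => // k IHk f ltk lefg lefh.
pose free s := (f s < g s) && [forall X : {set S}, (s \in X) ==> (\sum_(u in X) f u < h #|X|)].
have [/existsP[s /andP[ltfg /forallP freeX]]|nofree] := boolP [exists s, free s].
  pose f' u := f u + (u == s)%:Z.
  have [||X|m [boxm mh gem]] := IHk f'.
  - rewrite -ltnS; apply: leq_trans ltk; rewrite ltnS.
    rewrite (bigD1 s) //= [X in (_ < X)%N](bigD1 s) //= -addSn leq_add //.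
      by rewrite /f' eqxx; lia.
    by apply: leq_sum => u /negPf neu; rewrite /f' neu addr0.
  - by move=> u; rewrite /f'; case: eqP => [->|_]; have := lefg u; lia.
  - rewrite /f' sum_incr; have := implyP (freeX X); have := lefh X.
    by case: (s \in X) => le lt; [have := lt isT | ]; lia.
  exists m; split=> // u; have /andP[le1 le2] := boxm u; rewrite le2 andbT.
  by apply: le_trans le1; rewrite /f' lerDl.
have tight s : f s < g s -> exists2 X : {set S}, s \in X & \sum_(u in X) f u = h #|X|.
  move=> ltfg; move: nofree; rewrite negb_exists => /forallP/(_ s).
  rewrite /free ltfg => /forallPn[X]; rewrite negb_imply -leNgt => /andP[sX le].
  by exists X => //; apply/le_anti; rewrite lefh.
(* [h 0] is at most 0 by hypothesis and at least 0 as a bound on an empty sum. *)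
have tight0 : \sum_(u in set0) f u == h #|(set0 : {set S})|.
  by rewrite eq_le lefh big_set0 cards0.
case: (@arg_maxnP _ set0 (fun X : {set S} => \sum_(u in X) f u == h #|X|)
         (fun X => #|X|) tight0) => K /eqP tightK maxK.
have eqfg s : s \notin K -> f s = g s.
  move=> nKs; apply/eqP; rewrite eq_le lefg leNgt; apply/negP => /tight[X Xs tightX].
  have tightU : \sum_(u in K :|: X) f u == h #|K :|: X|.
    rewrite eq_le lefh -(lerD2r (h #|K :&: X|)); apply: le_trans (subm K X) _.
    by rewrite -tightK -tightX -sum_setUI lerD2l.
  have := maxK _ tightU; rewrite /= leqNgt => /negP[]; apply: proper_card.
  by apply/properP; split; [apply: subsetUl | exists s; rewrite // inE Xs orbT].
exists f; split=> // [s|]; first by rewrite lexx lefg.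
rewrite (sum_setC f K) tightK; apply: le_trans (geg K) _; rewrite lerD2l.
by apply: ler_sum => s; rewrite inE => /eqfg->.
Qed.

Lemma hull_singletons (T : finType) (p : {set T} -> int) :
  \sum_t p [set t] <= hull p 0.
Proof.
have pT : packing [set [set t] | t in T].
  apply/packingP; split=> [A B x /imsetP[t _ ->] /imsetP[u _ ->]|].
    by rewrite !inE => /eqP-> /eqP->.
  by apply/imsetP => -[t _ /setP/(_ t)]; rewrite !inE eqxx.
apply: le_trans (hull_ge p 0 pT); rewrite excessE muln0 subr0.
by rewrite big_imset //= => t u _ _; apply: set1_inj.
Qed.

(* At the lowest level at which the singleton of an unsaturated node t belongs to
   a tight packing, a single tight packing contains all these singletons. *)
Lemma saturate (S T : finType) (p : {set T} -> int) (C : T -> nat) (m : S -> int) :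
  pos_intersecting_supermodular p ->
  (forall X : {set S}, hull p #|X| <= \sum_(s in ~: X) m s) ->
  (forall X : {set S}, \sum_(s in X) m s + hull (raise C p) #|X| <=
                       \sum_t raise C p [set t]) ->
  exists c : T -> nat, [/\ forall t, (c t <= C t)%N,
    forall X : {set S}, hull (raise c p) #|X| <= \sum_(s in ~: X) m s &
    \sum_s m s <= \sum_t raise c p [set t]].
Proof.
move=> pis hull0 hullC.
have : exists c : T -> nat, (forall t, (c t <= C t)%N) /\
    forall X : {set S}, hull (raise c p) #|X| <= \sum_(s in ~: X) m s.
  exists (fun _ => 0%N); split=> // X; rewrite (@eq_hull _ _ p) // => W.
  by rewrite /raise big1 ?addr0.
case=> c []; have [k] := ubnP (\sum_t (C t - c t))%N.
elim: k c => // k IHk c ltk lecC hullc.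
have pisc : pos_intersecting_supermodular (raise c p) by apply: pis_raise.
pose c1 t u := (c u + (u == t))%N.
have raise_c1 t : raise (c1 t) p =1 raise (fun u => u == t) (raise c p).
  move=> W; rewrite -raiseD; congr (_ + _); apply: eq_bigr => u _.
  by rewrite /c1 addnC.
pose free t := (c t < C t)%N &&
  [forall X : {set S}, hull (raise (c1 t) p) #|X| <= \sum_(s in ~: X) m s].
have [/existsP[t /andP[ltc /forallP free_t]]|nofree] := boolP [exists t, free t].
  apply: (IHk (c1 t)) => //.
    rewrite -ltnS; apply: leq_trans ltk; rewrite ltnS.
    rewrite (bigD1 t) //= [X in (_ < X)%N](bigD1 t) //= -addSn leq_add //.
      by rewrite /c1 eqxx; lia.
    by apply: leq_sum => u /negPf neu; rewrite /c1 neu addn0.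
  by move=> u; rewrite /c1; case: eqP => [->|_]; rewrite ?addn1 ?addn0.
have eqraise : raise C p =1 raise (fun t => (C t - c t)%N) (raise c p).
  by move=> W; rewrite -raiseD; congr (_ + _); apply: eq_bigr => t _; rewrite subnK.
have sumC : \sum_t raise C p [set t] =
    \sum_t raise c p [set t] + \sum_t (C t - c t)%N%:Z.
  by rewrite -big_split; apply: eq_bigr => t _; rewrite eqraise raise_set1.
exists c; split=> //.
have [/forallP satur|/forallPn[t1 unsat1]] := boolP [forall t, c t == C t].
  have := hullC setT; rewrite sumC.
  have -> : \sum_t (C t - c t)%N%:Z = 0 :> int.
    by rewrite big1 // => t _; rewrite (eqP (satur t)) subnn.
  have -> : \sum_(s in [set: S]) m s = \sum_s m s by apply: eq_bigl => s; rewrite inE.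
  by rewrite addr0; apply: le_trans; rewrite lerDl hull_ge0.
(* Raising an unsaturated [t] violates the inequality of some [X]; a packing that witnesses this
   must contain the singleton of [t] and be optimal and tight before the raise. Saturated nodes get
   a dummy pair. *)
have tight t : exists XQ : {set S} * {set {set T}}, c t != C t ->
    [/\ hull (raise c p) #|XQ.1| = \sum_(s in ~: XQ.1) m s,
        optimal (raise c p) #|XQ.1| XQ.2 & [set t] \in XQ.2].
  have [eqc|nec] := eqVneq (c t) (C t); first by exists (set0, set0).
  have ltc : (c t < C t)%N by rewrite ltn_neqAle nec lecC.
  move: nofree; rewrite negb_exists => /forallP/(_ t); rewrite /free ltc /=.
  case/forallPn=> X; rewrite (eq_hull _ (raise_c1 t)) -ltNge.
  have [Q [[pQ _] <-]] := hull_optimal (raise (fun u => u == t) (raise c p)) #|X|.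
  have -> : excess (raise (fun u => u == t) (raise c p)) #|X| Q =
      excess (raise c p) #|X| Q + ([set t] \in Q)%:Z.
    rewrite excess_raise; congr (_ + _); rewrite big_mkcond (bigD1 t) //= eqxx.
    rewrite big1 ?addr0 => [|u /negPf->]; first by case: ifP.
    by case: ifP.
  have := hullc X; have := hull_ge (raise c p) #|X| pQ.
  case Qt : ([set t] \in Q) => /= le1 le2.
    rewrite ltzD1 => le3; exists (X, Q) => _ /=; split=> //.
      by apply/le_anti; rewrite le2 (le_trans le3 le1).
    by apply/optimalE; split=> //; apply/le_anti; rewrite le1 (le_trans le2 le3).
  by rewrite addr0 ltNge (le_trans le1 le2).
have [XQ XQ_tight] := fin_all_exists tight.
case: (@arg_minnP _ t1 (fun t => c t != C t) (fun t => #|(XQ t).1|) unsat1).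
move=> t0 unsat0 min0; set X := (XQ t0).1 in min0; set j := #|X| in min0.
have [hullX oQ0 _] := XQ_tight t0 unsat0.
have [P oP inP] : exists2 P, optimal (raise c p) j P &
    forall t, t \in enum T -> c t != C t -> [set t] \in P.
  elim: (enum T) => [|t l [P oP inP]]; first by exists (XQ t0).2.
  have [eqc|nec] := eqVneq (c t) (C t).
    by exists P => // u; rewrite inE => /orP[/eqP->|/inP//]; rewrite eqc eqxx.
  have [_ oQ Qt] := XQ_tight t nec.
  have [P' [oP' P't P'S]] := single_swap pisc (min0 t nec) oP oQ Qt.
  by exists P' => // u; rewrite inE => /orP[/eqP->//|/inP lu /lu/P'S].
have [pP exP] := proj1 (optimalE _ _ _) oP.
(* On [P] the raise from [c] to [C] gains the full remaining amount, which cancels in the hypothesis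
   on [raise C p] at [X]. *)
have := hullC X; have := hull_ge (raise C p) j pP; rewrite sumC.
have -> : excess (raise C p) j P = excess (raise c p) j P + \sum_t (C t - c t)%N%:Z.
  rewrite excessE (eq_bigr _ (fun W _ => eqraise W)) -excessE excess_raise.
  congr (_ + _); rewrite big_mkcond /=; apply: eq_bigr => t _; case: ifP => // nPt.
  have [->|nec] := eqVneq (c t) (C t); first by rewrite subnn.
  by rewrite inP ?mem_enum in nPt.
rewrite exP hullX (sum_setC m X) -/X; clear.
move: (hull _ _) (\sum_(s in X) m s) (\sum_(s in ~: X) m s) => a b d; lia.
Qed.

Lemma eq_of_sum_le (I : finType) (F G : I -> int) :
  (forall i, F i <= G i) -> \sum_i G i <= \sum_i F i -> forall i, F i = G i.
Proof.
move=> leFG leS i; apply/eqP; rewrite eq_sym -subr_eq0.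
have ge0 k : xpredT k -> 0 <= G k - F k by rewrite subr_ge0 leFG.
have : \sum_k (G k - F k) == 0.
  by rewrite eq_le sumr_ge0 ?andbT ?sumrB ?subr_le0.
by rewrite psumr_eq0 // => /allP/(_ i); rewrite mem_index_enum => /(_ isT).
Qed.

(** * Number of edges, degrees in S, and the graph *)

Section Assembly.
Variables (S T : finType) (p : {set T} -> int) (C : T -> nat).
Variables (f g : S -> int) (alpha beta : nat).
Hypothesis pis : pos_intersecting_supermodular p.
Hypothesis p0 : p set0 <= 0.
Hypothesis lefg : forall s, f s <= g s.
Local Notation G := (\sum_t raise C p [set t]).
Hypothesis hull_g : forall X : {set S}, hull p #|X| <= \sum_(s in ~: X) g s.
Hypothesis hull_f :
  forall X : {set S}, \sum_(s in X) f s + hull (raise C p) #|X| <= G.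
Hypothesis hull_alpha : forall X : {set S},
  alpha%:Z + hull (raise C p) #|X| <= \sum_(s in ~: X) g s + G.
Hypothesis hull_beta :
  forall X : {set S}, \sum_(s in X) f s + hull p #|X| <= beta%:Z.
Hypothesis le_alpha_beta : (alpha <= beta)%N.

Lemma cardsUI_le (X Z : {set S}) :
  [/\ (#|X :&: Z| <= #|X|)%N, (#|X :&: Z| <= #|Z|)%N &
      (#|X :&: Z| + #|X :|: Z| = #|X| + #|Z|)%N].
Proof.
by rewrite !subset_leq_card ?subsetIl ?subsetIr // addnC cardsUI.
Qed.

(** Every lower bound on the number of edges is below every upper bound: [hull_f] is used at
    [X :&: Z], [hull_g] at [X :|: Z], and [hull_raise] with [hull_convex] account for the change of
    levels. *)
Lemma edge_number_bounds (X Z : {set S}) :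
  \sum_(s in X) f s + hull p #|X| <=
  \sum_(s in ~: Z) g s + G - hull (raise C p) #|Z|.
Proof.
have [leX leZ eqc] := cardsUI_le X Z.
have sumf : \sum_(s in X) f s = \sum_(s in X :&: Z) f s + \sum_(s in X :\: Z) f s.
  exact: big_setID.
have sumg : \sum_(s in ~: Z) g s =
    \sum_(s in X :\: Z) g s + \sum_(s in ~: (X :|: Z)) g s.
  rewrite (big_setID X) /=; congr (_ + _); apply: eq_bigl => s; rewrite !inE;
    by case: (s \in X); case: (s \in Z).
have le_fg : \sum_(s in X :\: Z) f s <= \sum_(s in X :\: Z) g s by apply: ler_sum.
have := hull_f (X :&: Z); have := hull_g (X :|: Z).
have := hull_raise C pis leZ; have := hull_convex p leX leZ eqc.
rewrite sumf sumg; move: le_fg; clear.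
move: (\sum_(s in _) f s) (\sum_(s in _) f s) (\sum_(s in _) g s) (\sum_(s in _) g s).
lia.
Qed.

Lemma edge_number : exists gamma : int, [/\ alpha%:Z <= gamma <= beta%:Z,
  forall X : {set S}, \sum_(s in X) f s + hull p #|X| <= gamma &
  forall X : {set S}, gamma <= \sum_(s in ~: X) g s + G - hull (raise C p) #|X|].
Proof.
pose a (X : {set S}) := \sum_(s in X) f s + hull p #|X|.
(* The number of edges is the largest of all its lower bounds. *)
exists (\big[Num.max/alpha%:Z]_X a X); split=> [|X|X].
- rewrite bigmax_ge_id /=; apply: bigmax_le => [|X _]; first by rewrite lez_nat.
  exact: hull_beta.
- exact: (le_bigmax _ a X).
- apply: bigmax_le => [|Z _]; last exact: edge_number_bounds.
  by rewrite lerBrDr.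
Qed.

Lemma degree_sequence : exists m : S -> int,
  [/\ forall s, f s <= m s <= g s, alpha%:Z <= \sum_s m s <= beta%:Z,
      forall X : {set S}, hull p #|X| <= \sum_(s in ~: X) m s &
      forall X : {set S}, \sum_(s in X) m s + hull (raise C p) #|X| <= G].
Proof.
have [gamma [ab lega gele]] := edge_number.
(* The first term expresses the upper bounds on T; the second, once the degrees sum to [gamma], is
   the covering inequality for the complement. *)
pose h x := Num.min (G - hull (raise C p) x) (gamma - hull p x).
have leh x y : (y <= h x) = (y <= G - hull (raise C p) x) && (y <= gamma - hull p x).
  by rewrite le_min.
have [||X|X|m [boxm mh gem]] := @box_symmetric_polymatroid S f g h gamma _ _ lefg.
- move=> X Z; have [leX leZ eqc] := cardsUI_le X Z.
  have cX : (#|X| <= #|X :|: Z|)%N by rewrite subset_leq_card ?subsetUl.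
  have := hull_convex p leX leZ eqc; have := hull_convex (raise C p) leX leZ eqc.
  have := hull_raise C pis leX; have := hull_raise C pis leZ.
  rewrite /h; clear.
  move: (hull _ #|X|) (hull _ #|X|) (hull _ #|Z|) (hull _ #|Z|) => x1 x2 z1 z2.
  move: (hull _ _) (hull _ _) (hull _ _) (hull _ _) => i1 i2 u1 u2.
  by lia.
- rewrite /h ge_min; apply/orP; left; rewrite subr_le0; exact: hull_singletons.
- by rewrite leh !lerBrDr hull_f lega.
- rewrite -lerBlDr leh; have := gele X; have := hull_g X; clear.
  by move=> *; apply/andP; split; lia.
have sumT (F : S -> int) : \sum_(s in [set: S]) F s = \sum_s F s.
  by apply: eq_bigl => s; rewrite inE.
have summ : \sum_s m s = gamma.
  apply/le_anti; rewrite gem andbT; have := mh setT; rewrite sumT leh => /andP[_ le].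
  by apply: le_trans le _; rewrite gerBl hull_ge0.
exists m; split=> // [|X|X]; first by rewrite summ.
  have := mh X; rewrite leh => /andP[_]; rewrite -summ (sum_setC m X).
  by rewrite lerBrDr lerD2l.
by have := mh X; rewrite leh lerBrDr => /andP[].
Qed.

Lemma bounded_cover : exists E : {set S * T}, [/\ covers E p,
  forall s, f s <= (degree E (inl s))%:Z <= g s,
  forall t, p [set t] <= (degree E (inr t))%:Z <= p [set t] + (C t)%:Z &
  (alpha <= #|E| <= beta)%N].
Proof.
have [m [boxm summ hull_m m_hull]] := degree_sequence.
have [c [lecC hull_c le_sum]] := saturate pis hull_m m_hull.
have m0 s : 0 <= m s.
  have := hull_c (~: [set s]); rewrite setCK big_set1.
  exact: le_trans (hull_ge0 _ _).
have [||X|N [covN leN]] := @bounded_covering S T (raise c p) (fun s => absz (m s)).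
- exact: pis_raise.
- by rewrite raise_id // cards0.
- apply: le_trans (hull_c X) _; rewrite (big_morph Posz PoszD (erefl _)).
  by apply: ler_sum => s _; rewrite gez0_abs.
pose E := [set st : S * T | st.2 \in N st.1].
have degS s : degree E (inl s) = #|N s|.
  by apply: eq_card => t; rewrite !inE.
have degT t : degree E (inr t) = (\sum_s hit (N s) [set t])%N.
  rewrite /= -sum1_card big_mkcond /=; apply: eq_bigr => s _; rewrite !inE /hit.
  case: set0Pn => [[u]|no]; first by rewrite !inE => /andP[+ /eqP<-] => ->.
  by case: ifP => // Nst; case: no; exists t; rewrite !inE Nst eqxx.
have sumE : #|E| = (\sum_s degree E (inl s))%N.
  rewrite (eq_bigr _ (fun s _ => degS s)) -sum1_card.
  rewrite (eq_bigr (fun s => \sum_(t in N s) 1)%N) => [|s _]; last by rewrite sum1_card.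
  by rewrite pair_big_dep /=; apply: eq_bigl => -[s t]; rewrite inE.
have sumST : (\sum_s degree E (inl s) = \sum_t degree E (inr t))%N.
  under eq_bigr do rewrite degS -sum1_card big_mkcond /=.
  rewrite exchange_big /=; apply: eq_bigr => t _.
  rewrite -sum1_card [RHS]big_mkcond /=; apply: eq_bigr => s _.
  by rewrite !inE.
have le_degS s : (degree E (inl s))%:Z <= m s.
  by have := leN s; rewrite degS; have := m0 s; lia.
have le_degT t : raise c p [set t] <= (degree E (inr t))%:Z.
  by rewrite degT; apply: covN.
have PoszS (I : finType) (F : I -> nat) : (\sum_i F i)%N%:Z = \sum_i (F i)%:Z.
  exact: (big_morph Posz PoszD (erefl _)).
have sumS_le : \sum_s (degree E (inl s))%:Z <= \sum_s m s by apply: ler_sum.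
have sumT_ge : \sum_t raise c p [set t] <= \sum_t (degree E (inr t))%:Z.
  by apply: ler_sum.
have eqST : \sum_s (degree E (inl s))%:Z = \sum_t (degree E (inr t))%:Z.
  by rewrite -!PoszS sumST.
have eqS : forall s, (degree E (inl s))%:Z = m s.
  apply: eq_of_sum_le => //.
  by apply: le_trans le_sum _; rewrite eqST.
have eqT : forall t, raise c p [set t] = (degree E (inr t))%:Z.
  apply: eq_of_sum_le => //.
  by rewrite -eqST; apply: le_trans le_sum.
exists E; split=> [W|s|t|].
- have -> : #|neighbours E W| = (\sum_s hit (N s) W)%N.
    rewrite -sum1_card big_mkcond /=; apply: eq_bigr => s _; rewrite !inE /hit.
    congr (nat_of_bool _); apply/exists_inP/set0Pn => -[t].
      by rewrite inE /= => Wt Nt; exists t; rewrite inE Nt.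
    by rewrite inE => /andP[Nt Wt]; exists t; rewrite // inE.
  exact: le_trans (le_raise c p W) (covN W).
- by rewrite eqS.
- by rewrite -eqT raise_set1 lerDl lerD2l !lez_nat lecC.
- by rewrite sumE -!lez_nat PoszS (eq_bigr _ (fun s _ => eqS s)).
Qed.

End Assembly.

(** * Reduction to finite bounds *)

Section Subpartitions.
Variable T : finType.
Implicit Types (P Q : {set {set T}}) (A D W Y : {set T}).

Lemma subpartition_packing P A : subpartition P A -> packing P.
Proof. by case/and3P=> _ triP nP0; rewrite /packing triP. Qed.

Lemma packing_card_meet P D : packing P ->
  (forall W, W \in P -> W :&: D != set0) -> (#|P| <= #|D|)%N.
Proof.
move=> /andP[triP _] meetD.
apply: (@leq_trans (\sum_(W in P) #|W :&: D|)).
  by rewrite -sum1_card leq_sum // => W /meetD; rewrite card_gt0.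
have -> : (\sum_(W in P) #|W :&: D| = \sum_(W in P) \sum_(t in W) (t \in D))%N.
  apply: eq_bigr => W _; rewrite -sum1_card [RHS]big_mkcond /= [LHS]big_mkcond.
  by apply: eq_bigr => t _; rewrite inE; case: (t \in W); case: (t \in D).
rewrite -(big_trivIset P triP) -sum1_card big_mkcond [X in (_ <= X)%N]big_mkcond /=.
by apply: leq_sum => t _; case: ifP; case: ifP.
Qed.

Lemma subpartition_card P A : subpartition P A -> (#|P| <= #|A|)%N.
Proof.
move=> sP; have pP := subpartition_packing sP; apply: packing_card_meet => // W PW.
suff -> : W :&: A = W by apply: mem_packing PW.
apply/setIidPl; case/and3P: sP => sPA _ _; apply: subset_trans sPA.
exact: (bigcup_sup W).
Qed.

Lemma subpartition0 A : subpartition set0 A.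
Proof.
by apply/and3P; split; rewrite ?inE // /cover ?big_set0 ?sub0set //;
   case/andP: (packing0 T).
Qed.

Lemma subpartition1 A W : W != set0 -> W \subset A -> subpartition [set W] A.
Proof.
move=> nW0 sWA; apply/and3P; split; first by rewrite /cover big_set1.
  by case/andP: (packing1 nW0).
by case/andP: (packing1 nW0).
Qed.

(** The members not inside [~: Y'] are dropped. They are disjoint and each meets [Y' :\: Y], which
    bounds their number; each is worth at most [b]. *)
Lemma subpartition_drop (p : {set T} -> int) (b : nat) P Y Y' :
  (forall W, p W <= b%:Z) -> subpartition P (~: Y) -> Y \subset Y' ->
  exists Q d, [/\ subpartition Q (~: Y'), (#|Y| + d <= #|Y'|)%N,
    (#|P| = #|Q| + d)%N & sumP p P <= sumP p Q + (d * b)%N%:Z].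
Proof.
move=> leb sP sYY'; have pP := subpartition_packing sP.
pose Q := [set W in P | W \subset ~: Y'].
have sQP : Q \subset P by apply/subsetP => W; rewrite inE => /andP[].
have cardP : (#|P| = #|Q| + #|P :\: Q|)%N.
  by rewrite -(cardsID Q P) (setIidPr sQP).
exists Q, #|P :\: Q|; split=> //.
- apply/and3P; split; first by apply/bigcupsP => W; rewrite inE => /andP[].
    by case/andP: (packingS sQP pP).
  by case/andP: (packingS sQP pP).
- have -> : #|Y'| = (#|Y| + #|Y' :\: Y|)%N by rewrite -(cardsID Y Y') (setIidPr sYY').
  rewrite leq_add2l; apply: packing_card_meet.
    by apply: packingS pP; apply: subsetDl.
  move=> W /setDP[PW]; rewrite inE PW /= => /subsetPn[t Wt].
  rewrite inE negbK => Y't; apply/set0Pn; exists t; rewrite !inE Wt Y't andbT /=.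
  case/and3P: sP => /subsetP/(_ t) + _ _; rewrite inE; apply.
  exact: in_cover Wt.
- rewrite /sumP (big_setID Q) /= (setIidPr sQP) lerD2l.
  apply: (@le_trans _ _ (\sum_(W in P :\: Q) b%:Z)); first by apply: ler_sum.
  by rewrite sumr_const -mulr_natr natz PoszM mulrC.
Qed.

(** Turns a packing for the raised function into a pair [(Y, Q)] as in the theorem: singletons of
    nodes in [Y] carry degree bounds, and on the rest the raised function agrees with [p]. *)
Lemma split_singletons (p : {set T} -> int) c j P Y : packing P ->
  (forall t, t \in Y -> [set t] \in P) ->
  (forall t, [set t] \in P -> t \notin Y -> c t = 0%N) ->
  exists Q, subpartition Q (~: Y) /\
    excess (raise c p) j P =
    \sum_(t in Y) raise c p [set t] + sumP p Q - ((#|Y| + #|Q|) * j)%N%:Z.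
Proof.
move=> pP inP outY; pose YY := [set [set t] | t in Y]; pose Q := P :\: YY.
have sYP : YY \subset P by apply/subsetP => _ /imsetP[t /inP ? ->].
have pQ : packing Q by apply: packingS pP; apply: subsetDl.
have injY : {in Y &, injective (fun t : T => [set t])} by move=> t u _ _ /set1_inj.
have cQ : cover Q \subset ~: Y.
  rewrite packing_coverD //; apply/subsetP => t; rewrite !inE => /andP[+ _].
  by apply: contra => Yt; apply: (in_cover (A := [set t])); rewrite ?inE // imset_f.
exists Q; split; first by apply/and3P; case/andP: pQ.
rewrite excessE (big_setID YY) /= (setIidPr sYP) big_imset //= -/Q.
have -> : \sum_(W in Q) raise c p W = sumP p Q.
  apply: eq_bigr => W QW.
  have [/cards1P[t eqW]|W1] := boolP (#|W| == 1%N); last exact: raise_id.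
  have /andP[nYW PW] : (W \notin YY) && (W \in P) by rewrite -in_setD.
  rewrite eqW raise_set1 outY ?addr0 -?eqW //.
  by apply: contra nYW => Yt; rewrite eqW imset_f.
have -> : #|P| = (#|Y| + #|Q|)%N.
  by rewrite -(cardsID YY P) (setIidPr sYP) card_in_imset.
by [].
Qed.

Lemma sumP_cover (p : {set T} -> int) P : fully_supermodular p -> p set0 = 0 ->
  packing P -> sumP p P <= p (cover P).
Proof.
move=> fsup p0; have [k] := ubnP #|P|; elim: k P => // k IHk P ltk pP.
have [->|/set0Pn[W PW]] := eqVneq P set0.
  by rewrite /sumP /cover !big_set0 p0.
rewrite /sumP (big_setD1 W PW) /=.
have := IHk (P :\ W); rewrite (cardsD1 W P) PW add1n in ltk.
move=> /(_ ltk (packingS (subsetDl _ _) pP)); rewrite /sumP => le.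
apply: le_trans (lerD (lexx _) le) _.
apply: le_trans (fsup _ _) _.
have -> : W :|: cover (P :\ W) = cover P by rewrite /cover [RHS](big_setD1 W).
suff -> : W :&: cover (P :\ W) = set0 by rewrite p0 add0r.
rewrite packing_coverD ?sub1set // /cover big_set1.
by apply/setP => t; rewrite !inE; case: (t \in W); rewrite ?andbF.
Qed.

End Subpartitions.

Section Capping.
Variable I : finType.
Implicit Types (X : {set I}).

(** No degree of a simple graph exceeds the size [b] of the other side, so larger or infinite upper
    bounds may be replaced by [b]. *)
Definition cap (g : I -> \bar int) (b : nat) (i : I) : int :=
  if g i is r%:E then Num.min r b%:Z else b%:Z.

Definition nonneg_part (f : I -> \bar int) (i : I) : int :=
  if f i is r%:E then Num.max r 0 else 0.

(** Leads from capped bounds back to the original ones: elements whose bound is infinite or exceeds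
    [b] move into [X'] and are accounted for by [b] each. *)
Lemma sum_cap g b X : (forall i, g i <> -oo%E) -> exists X', [/\ X \subset X',
    forall i, i \notin X' -> g i = (fine (g i))%:E &
    \sum_(i in ~: X) cap g b i =
    \sum_(i in ~: X') fine (g i) + ((#|X'| - #|X|) * b)%N%:Z].
Proof.
move=> g_fin; pose big i := if g i is r%:E then b%:Z < r else true.
pose K := [set i in ~: X | big i].
have cardK : (#|X :|: K| - #|X|)%N = #|K|.
  rewrite cardsU (_ : X :&: K = set0) ?cards0 ?subn0 ?addKn //.
  by apply/setP => i; rewrite !inE; case: (i \in X).
exists (X :|: K); split; first exact: subsetUl.
  move=> i; rewrite !inE negb_or negb_and negbK => /andP[/negPf->] /=.
  by rewrite /big; case: (g i) (g_fin i).
rewrite cardK (big_setID K) /= addrC; congr (_ + _).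
  have -> : ~: X :\: K = ~: (X :|: K) by rewrite setCU setDE.
  apply: eq_bigr => i; rewrite !inE negb_or negb_and negbK => /andP[/negPf->] /=.
  rewrite /big /cap; case: (g i) (g_fin i) => // r _; rewrite -leNgt => ler.
  by rewrite (min_idPl ler).
have -> : ~: X :&: K = K by apply/setIidPr/subsetP => i; rewrite !inE => /andP[].
rewrite (eq_bigr (fun _ => b%:Z)) => [|i].
  by rewrite sumr_const -mulr_natr natz PoszM mulrC.
rewrite inE /big /cap => /andP[_]; case: (g i) (g_fin i) => // r _ /ltW ltb.
by rewrite (min_idPr ltb).
Qed.

Lemma sum_nonneg_part f X : (forall i, f i <> +oo%E) -> exists X', [/\ X' \subset X,
    forall i, i \in X' -> f i = (fine (f i))%:E &
    \sum_(i in X) nonneg_part f i = \sum_(i in X') fine (f i)].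
Proof.
move=> f_fin; pose pos i := if f i is r%:E then 0 <= r else false.
exists [set i in X | pos i]; split.
- by apply/subsetP => i; rewrite inE => /andP[].
- by move=> i; rewrite inE /pos => /andP[_]; case: (f i).
rewrite big_mkcond [RHS]big_mkcond /=; apply: eq_bigr => i _; rewrite inE.
case: (i \in X) => //=; rewrite /nonneg_part /pos.
case: (f i) (f_fin i) => // r _; case: ifP => [/max_idPl //|/negbT].
by rewrite -ltNge => /ltW/max_idPr.
Qed.

End Capping.

(** * Edge counts behind the necessity of the conditions *)

Section Counting.
Variables (S T : finType) (p : {set T} -> int) (E : {set S * T}).
Hypothesis covE : covers E p.
Implicit Types (X : {set S}) (Y : {set T}) (P : {set {set T}}).

Let adj s t : nat := (s, t) \in E.
Let between X Y := (\sum_(s in X) \sum_(t in Y) adj s t)%N.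

Lemma natsum_setC (I : finType) (F : I -> nat) (X : {set I}) :
  (\sum_i F i = \sum_(i in X) F i + \sum_(i in ~: X) F i)%N.
Proof.
by rewrite (bigID [in X]) /=; congr (_ + _)%N; apply: eq_bigl => i; rewrite inE.
Qed.

Lemma sum_degS X Y :
  (\sum_(s in X) degree E (inl s) = between X Y + between X (~: Y))%N.
Proof.
rewrite /between -big_split; apply: eq_bigr => s _; rewrite /= -natsum_setC.
by rewrite -sum1_card big_mkcond; apply: eq_bigr => t _; rewrite inE.
Qed.

Lemma sum_degT X Y :
  (\sum_(t in Y) degree E (inr t) = between X Y + between (~: X) Y)%N.
Proof.
have exch Z : between Z Y = (\sum_(t in Y) \sum_(s in Z) adj s t)%N by exact: exchange_big.
rewrite !exch -big_split; apply: eq_bigr => t Yt.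
rewrite /= -sum1_card big_mkcond (natsum_setC _ X).
by congr (_ + _)%N; apply: eq_bigr => s _; rewrite inE.
Qed.

Lemma card_edges X Y : #|E| =
  (between X Y + between X (~: Y) + between (~: X) Y + between (~: X) (~: Y))%N.
Proof.
rewrite -addnA -!sum_degS -natsum_setC -sum1_card big_mkcond.
rewrite (eq_bigr (fun s => \sum_t adj s t)%N) => [|s _].
  by rewrite pair_big /=; apply: eq_bigr => -[s t] _ /=.
by rewrite /= -sum1_card big_mkcond; apply: eq_bigr => t _; rewrite inE.
Qed.

Lemma between_le X Y : (between X Y <= #|X| * #|Y|)%N.
Proof.
rewrite /between -sum_nat_const leq_sum // => s _.
by rewrite -sum1_card leq_sum // => t _; apply: leq_b1.
Qed.

(** A neighbour of a member [W] lies in [X] or sends an edge from [~: X] into [W], and disjoint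
    members receive different edges. *)
Lemma between_ge X Y P : subpartition P (~: Y) ->
  sumP p P <= (between (~: X) (~: Y) + #|X| * #|P|)%N%:Z.
Proof.
move=> /and3P[sPY triP _].
pose met s (W : {set T}) : nat := [exists t in W, (s, t) \in E].
have le1 : (\sum_(W in P) \sum_(s in ~: X) met s W <= between (~: X) (~: Y))%N.
  rewrite exchange_big /=; apply: leq_sum => s _.
  apply: (@leq_trans (\sum_(t in cover P) adj s t)%N).
    rewrite (big_trivIset P triP) /=; apply: leq_sum => W _; rewrite /met.
    case: exists_inP => // -[t Wt Est].
    by rewrite (bigD1 t) //= /adj Est.
  by rewrite [X in (_ <= X)%N](big_setID (cover P)) /= (setIidPr sPY) leq_addr.
apply: (@le_trans _ _ (\sum_(W in P) (\sum_(s in ~: X) met s W + #|X|)%N%:Z)).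
  apply: ler_sum => W _; apply: le_trans (covE W) _; rewrite lez_nat.
  rewrite -sum1_card big_mkcond (natsum_setC _ X) addnC leq_add //.
    by apply: leq_sum => s _; rewrite inE.
  by rewrite -sum1_card leq_sum // => s _; case: ifP.
rewrite -(big_morph Posz PoszD (erefl _)) lez_nat big_split /=.
by rewrite sum_nat_const mulnC leq_add2r.
Qed.

Lemma edges_upper X Y P : subpartition P (~: Y) ->
  #|E|%:Z + sumP p P <= (\sum_(s in ~: X) degree E (inl s))%N%:Z +
    (\sum_(t in ~: Y) degree E (inr t))%N%:Z + (#|X| * #|Y|)%N%:Z
    + (#|X| * #|P|)%N%:Z.
Proof.
move=> /(between_ge X); have := between_le X Y.
by rewrite (card_edges X Y) (sum_degS (~: X) Y) (sum_degT X (~: Y)); clear; lia.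
Qed.

Lemma edges_lower X Y P : subpartition P (~: Y) ->
  (\sum_(s in X) degree E (inl s))%N%:Z + (\sum_(t in Y) degree E (inr t))%N%:Z
    + sumP p P <= #|E|%:Z + (#|X| * #|Y|)%N%:Z + (#|X| * #|P|)%N%:Z.
Proof.
move=> /(between_ge X); have := between_le X Y.
by rewrite (card_edges X Y) (sum_degS X Y) (sum_degT X Y); clear; lia.
Qed.

End Counting.

(** * From extended bounds to finite ones *)

Section Reduction.
Variables (S T : finType) (f g : S + T -> \bar int) (p : {set T} -> int).
Hypothesis f_fin : forall v, f v <> +oo%E.
Hypothesis g_fin : forall v, g v <> -oo%E.
Hypothesis le_fg : forall v, (f v <= g v)%E.
Hypothesis pis : pos_intersecting_supermodular p.
Hypothesis p0 : p set0 = 0.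
Hypothesis p_bound : forall Y : {set T}, p Y <= #|S|%:Z.
Variable adm : {set T} -> {set {set T}} -> bool.
(** Every subpartition can be replaced by an admissible one that is at least as restrictive for each
    |X|; the three versions of the theorem differ only in how this is met. *)
Hypothesis adm_dominates : forall Y P, subpartition P (~: Y) ->
  exists P', [/\ subpartition P' (~: Y), adm Y P' &
    forall x : nat, sumP p P - (#|P| * x)%N%:Z <= sumP p P' - (#|P'| * x)%N%:Z].
Implicit Types (X : {set S}) (Y : {set T}) (P : {set {set T}}).

Lemma lower_necessary E alpha :
  realization f g p E -> (alpha <= #|E|)%N -> lower_condition g p adm alpha.
Proof.
move=> [covE degE] leE X Y P sP _.
have := edges_upper covE X sP.
set dS := (\sum_(s in ~: X) _)%N; set dT := (\sum_(t in ~: Y) _)%N => leD.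
have gS : (dS%:Z%:E <= sumS g (~: X))%E.
  rewrite /dS (big_morph Posz PoszD (erefl _)) -sumEFin.
  by apply: lee_sum => s _; have [] := degE (inl s).
have gT : (dT%:Z%:E <= sumT g (~: Y))%E.
  rewrite /dT (big_morph Posz PoszD (erefl _)) -sumEFin.
  by apply: lee_sum => t _; have [] := degE (inr t).
apply: (@le_trans _ _ (dS%:Z%:E + dT%:Z%:E + (#|X| * #|Y|)%N%:Z%:E
                       - (sumP p P - (#|X| * #|P|)%N%:Z)%:E)%E).
  by rewrite -!EFinD lee_fin; move: leD leE; clear; lia.
by do 2 apply: leeD => //; apply: leeD.
Qed.

Lemma upper_necessary E beta :
  realization f g p E -> (#|E| <= beta)%N -> upper_condition f p adm beta.
Proof.
move=> [covE degE] leE X Y P sP _.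
have := edges_lower covE X sP.
set dS := (\sum_(s in X) _)%N; set dT := (\sum_(t in Y) _)%N => leD.
have fS : (sumS f X <= dS%:Z%:E)%E.
  rewrite /dS (big_morph Posz PoszD (erefl _)) -sumEFin.
  by apply: lee_sum => s _; have [] := degE (inl s).
have fT : (sumT f Y <= dT%:Z%:E)%E.
  rewrite /dT (big_morph Posz PoszD (erefl _)) -sumEFin.
  by apply: lee_sum => t _; have [] := degE (inr t).
apply: (@le_trans _ _ (dS%:Z%:E + dT%:Z%:E - (#|X| * #|Y|)%N%:Z%:E
                       + (sumP p P)%:E - (#|X| * #|P|)%N%:Z%:E)%E).
  by do 3 apply: leeD => //; apply: leeD.
by rewrite -!EFinD lee_fin; move: leD leE; clear; lia.
Qed.

Let finite_on (I : finType) (h : I -> \bar int) (A : {set I}) :=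
  forall i, i \in A -> h i = (fine (h i))%:E.
Lemma finite_on0 (I : finType) (h : I -> \bar int) : finite_on h set0.
Proof. by move=> i; rewrite inE. Qed.

Lemma finite_on1 (I : finType) (h : I -> \bar int) i r : h i = r%:E -> finite_on h [set i].
Proof. by move=> hi u; rewrite inE => /eqP->; rewrite hi. Qed.

Let fS s := f (inl s).
Let fT t := f (inr t).
Let gS s := g (inl s).
Let gT t := g (inr t).

Lemma sumS_fine (h : S + T -> \bar int) X : finite_on (h \o inl) X ->
  sumS h X = (\sum_(s in X) fine (h (inl s)))%:E.
Proof. by move=> fin; rewrite -sumEFin; apply: eq_bigr. Qed.

Lemma sumT_fine (h : S + T -> \bar int) Y : finite_on (h \o inr) Y ->
  sumT h Y = (\sum_(t in Y) fine (h (inr t)))%:E.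
Proof. by move=> fin; rewrite -sumEFin; apply: eq_bigr. Qed.

Lemma lower_fine alpha X Y P : lower_condition g p adm alpha ->
  subpartition P (~: Y) -> finite_on gS (~: X) -> finite_on gT (~: Y) ->
  alpha%:Z + sumP p P <= \sum_(s in ~: X) fine (gS s) +
    \sum_(t in ~: Y) fine (gT t) + (#|X| * (#|Y| + #|P|))%N%:Z.
Proof.
move=> cond sP finS finT; have [P' [sP' aP' /(_ #|X|) le]] := adm_dominates sP.
have := cond X Y P' sP' aP'; rewrite sumS_fine // sumT_fine //.
rewrite -!EFinD lee_fin; move: le; rewrite /fS /fT /gS /gT; clear.
by rewrite mulnDr ![(#|X| * _)%N]mulnC; lia.
Qed.

Lemma upper_fine beta X Y P : upper_condition f p adm beta ->
  subpartition P (~: Y) -> finite_on fS X -> finite_on fT Y ->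
  \sum_(s in X) fine (fS s) + \sum_(t in Y) fine (fT t) + sumP p P <=
    beta%:Z + (#|X| * (#|Y| + #|P|))%N%:Z.
Proof.
move=> cond sP finS finT; have [P' [sP' aP' /(_ #|X|) le]] := adm_dominates sP.
have := cond X Y P' sP' aP'; rewrite sumS_fine // sumT_fine //.
rewrite -!EFinD lee_fin; move: le; rewrite /fS /fT /gS /gT; clear.
by rewrite mulnDr ![(#|X| * _)%N]mulnC; lia.
Qed.

Hypothesis feasible : feasibility_condition f g p adm.

Lemma feasible_gS X Y P :
  subpartition P (~: Y) -> finite_on fT Y -> finite_on gS (~: X) ->
  \sum_(t in Y) fine (fT t) + sumP p P <=
    \sum_(s in ~: X) fine (gS s) + (#|X| * (#|Y| + #|P|))%N%:Z.
Proof.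
move=> sP finT finS; have [P' [sP' aP' /(_ #|X|) le]] := adm_dominates sP.
have [+ _] := feasible X sP' aP'; rewrite sumS_fine // sumT_fine //.
rewrite -!EFinD lee_fin; move: le; rewrite /fS /fT /gS /gT; clear.
by rewrite mulnDr ![(#|X| * _)%N]mulnC; lia.
Qed.

Lemma feasible_gT X Y P :
  subpartition P (~: Y) -> finite_on fS X -> finite_on gT (~: Y) ->
  \sum_(s in X) fine (fS s) + sumP p P <=
    \sum_(t in ~: Y) fine (gT t) + (#|X| * (#|Y| + #|P|))%N%:Z.
Proof.
move=> sP finS finT; have [P' [sP' aP' /(_ #|X|) le]] := adm_dominates sP.
have [_ +] := feasible X sP' aP'; rewrite sumS_fine // sumT_fine //.
rewrite -!EFinD lee_fin; move: le; rewrite /fS /fT /gS /gT; clear.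
by rewrite mulnDr ![(#|X| * _)%N]mulnC; lia.
Qed.

Let gS' := cap gS #|T|.
Let gT' := cap gT #|S|.
Let fS' := nonneg_part fS.
(** Lower bounds on T are absorbed into [q] by raising [p [set t]] to the bound where it is smaller;
    [C] is the further raise to the capped upper bounds. *)
Let c t : nat := if fT t is r%:E then absz (Num.max 0 (r - p [set t])) else 0%N.
Let q := raise c p.
Let C t : nat := absz (gT' t - q [set t]).

Lemma fT_le_q t r : fT t = r%:E -> r <= q [set t].
Proof. by rewrite /q raise_set1 /c => ->; lia. Qed.

Lemma q_fT t : (0 < c t)%N -> fT t = (q [set t])%:E.
Proof.
rewrite /q raise_set1 /c; case: (fT t) => // r; rewrite absz_gt0 => nr.
by congr (_%:E); lia.
Qed.

Lemma gS'_ge0 s : 0 <= gS' s.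
Proof.
rewrite /gS' /cap; case gs : (gS s) => [r||] //.
rewrite le_min lez_nat andbT.
have := @feasible_gS (~: [set s]) set0 set0 (subpartition0 _) (finite_on0 _).
rewrite setCK => /(_ (finite_on1 gs)).
by rewrite big_set1 /sumP !big_set0 !cards0 addn0 muln0 gs addr0 addr0.
Qed.

Lemma fS'_le_gS' s : fS' s <= gS' s.
Proof.
have := gS'_ge0 s; rewrite /fS' /nonneg_part; case fs : (fS s) => [r||] // g0.
rewrite ge_max g0 andbT /gS' /cap.
have le_rT : r <= #|T|%:Z.
  have := @feasible_gT [set s] setT set0 (subpartition0 _) (finite_on1 fs).
  rewrite setCT => /(_ (finite_on0 _)).
  rewrite big_set1 /sumP !big_set0 !cards0 cards1 addn0 mul1n fs cardsT /=.
  by rewrite addr0 add0r.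
case gs : (gS s) => [r'||] //; rewrite le_min le_rT andbT.
by have := le_fg (inl s); rewrite -/(fS s) -/(gS s) fs gs lee_fin.
Qed.

(** Ensures that the absolute value in [C] is the difference itself. Feasibility is applied to the
    subpartition consisting of the singleton of [t], and to [X] = S with [Y] the singleton. *)
Lemma q_le_gT' t : q [set t] <= gT' t.
Proof.
have le_p : p [set t] <= gT' t.
  rewrite /gT' /cap; case gt : (gT t) => [r||]; [|exact: p_bound|exact: p_bound].
  rewrite le_min p_bound andbT.
  have nt0 : [set t] != set0 by apply/set0Pn; exists t; rewrite inE.
  have := @feasible_gT set0 (~: [set t]) [set [set t]].
  rewrite setCK => /(_ (subpartition1 nt0 (subxx _)) (finite_on0 _) (finite_on1 gt)).
  by rewrite /sumP !big_set1 big_set0 cards0 gt mul0n add0r addr0.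
have [c0|/q_fT ft] := posnP (c t); first by rewrite /q raise_set1 c0 addr0.
rewrite /gT' /cap.
have le_qS : q [set t] <= #|S|%:Z.
  have := @feasible_gS setT [set t] set0 (subpartition0 _) (finite_on1 ft).
  rewrite setCT => /(_ (finite_on0 _)).
  rewrite big_set1 /sumP !big_set0 !cards0 cards1 addn0 muln1 ft cardsT /=.
  by rewrite addr0 add0r.
case gt : (gT t) => [r||] //.
by rewrite le_min le_qS andbT; have := le_fg (inr t); rewrite -/(fT t) -/(gT t) ft gt lee_fin.
Qed.

Lemma raise_gT' t : raise C q [set t] = gT' t.
Proof. by rewrite raise_set1 /C; have := q_le_gT' t; lia. Qed.

Lemma pis_q : pos_intersecting_supermodular q.
Proof. exact: pis_raise. Qed.

Lemma raise_raise : raise C q =1 raise (fun t => (C t + c t)%N) p.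
Proof. by move=> W; rewrite raiseD. Qed.

(** Bookkeeping for enlarging [Y] by [l] nodes while dropping [d] members: the remaining [l - d]
    units cost [x] each, and capping pays [s] for each. *)
Lemma trade_off x x' s y l d n : (x' <= x)%N -> (x <= s)%N -> (d <= l)%N ->
  (x' * (y + l + n) + d * s <= x * (y + (n + d)) + l * s)%N.
Proof.
move=> le1 le2 le3; have : (x' * (y + l + n) <= x * (y + l + n))%N by rewrite leq_mul2r le1 orbT.
have : ((l - d) * x <= (l - d) * s)%N by rewrite leq_mul2l le2 orbT.
by rewrite -(subnK le3) addnK; lia.
Qed.

Lemma q_packing j P : packing P -> exists Y Q, [/\ subpartition Q (~: Y),
  finite_on fT Y & excess q j P =
  \sum_(t in Y) fine (fT t) + sumP p Q - ((#|Y| + #|Q|) * j)%N%:Z].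
Proof.
(* Only singletons that were really raised enter [Y], since there [q] equals the finite lower
   bound. *)
move=> pP; pose Y := [set t | ([set t] \in P) && (0 < c t)%N].
have [||Q [sQ ->]] := @split_singletons T p c j P Y pP.
- by move=> t; rewrite inE => /andP[].
- by move=> t Pt; rewrite inE Pt /= -eqn0Ngt => /eqP.
exists Y, Q; split=> //.
  by move=> t; rewrite inE => /andP[_ /q_fT->].
congr (_ + _ - _); apply: eq_bigr => t; rewrite inE => /andP[_ /q_fT->].
by [].
Qed.

Lemma gT'_packing j P : packing P -> exists Y Q, subpartition Q (~: Y) /\
  excess (raise C q) j P =
  \sum_(t in Y) gT' t + sumP p Q - ((#|Y| + #|Q|) * j)%N%:Z.
Proof.
(* All singletons of [P] enter [Y], since [raise C q] equals the capped upper bound at every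
   node. *)
move=> pP; pose Y := [set t | [set t] \in P].
have [||Q [sQ exQ]] := @split_singletons T p (fun t => (C t + c t)%N) j P Y pP.
- by move=> t; rewrite inE.
- by move=> t Pt; rewrite inE Pt.
exists Y, Q; split=> //.
have -> : excess (raise C q) j P = excess (raise (fun t => (C t + c t)%N) p) j P.
  by apply: eq_bigr => W _; rewrite raise_raise.
rewrite exQ; congr (_ + _ - _); apply: eq_bigr => t _.
by rewrite -raise_raise raise_gT'.
Qed.

Lemma hull_gS' X : hull q #|X| <= \sum_(s in ~: X) gS' s.
Proof.
apply: hull_le => P /(q_packing #|X|)[Y [Q [sQ finT ->]]].
have [X' [sXX' finS ->]] := @sum_cap S gS #|T| X (fun s => @g_fin (inl s)).
have finX' : finite_on gS (~: X') by move=> s; rewrite inE => /finS.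
have := feasible_gS sQ finT finX'.
have cardX : (#|X| <= #|X'|)%N by apply: subset_leq_card.
(* A node moved into [X'] by capping costs [#|Y| + #|Q|], which is at most the [#|T|] that it
   contributes. *)
have cardQ : (#|Y| + #|Q| <= #|T|)%N.
  by rewrite -(cardsC Y) leq_add2l subpartition_card.
have le : (#|X'| * (#|Y| + #|Q|) <=
          (#|Y| + #|Q|) * #|X| + (#|X'| - #|X|) * #|T|)%N.
  rewrite -{1}(subnK cardX) mulnDl [(#|X| * _)%N]mulnC addnC leq_add2l.
  by rewrite leq_mul2l cardQ orbT.
move: le; rewrite -/gS.
by move: (#|X'| * _)%N ((_ + _) * _)%N ((_ - _) * _)%N; clear; lia.
Qed.

(** Subtracting the part of [Y] from the total of [gT'] leaves a sum over [~: Y], to which capping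
    and [subpartition_drop] apply. *)
Lemma hull_fS' X :
  \sum_(s in X) fS' s + hull (raise C q) #|X| <= \sum_t raise C q [set t].
Proof.
rewrite -lerBrDl; apply: hull_le => P /(gT'_packing #|X|)[Y [Q [sQ ->]]].
rewrite (eq_bigr _ (fun t _ => raise_gT' t)) (sum_setC gT' Y).
have [X' [sX'X finS ->]] := @sum_nonneg_part S fS X (fun s => @f_fin (inl s)).
have [Y' [sYY' finT ->]] := @sum_cap T gT #|S| Y (fun t => @g_fin (inr t)).
have [Q' [d [sQ' led cardQ leQ]]] := subpartition_drop p_bound sQ sYY'.
have finY' : finite_on gT (~: Y') by move=> t; rewrite inE => /finT.
have := feasible_gT sQ' finS finY'.
have led' : (d <= #|Y'| - #|Y|)%N by move: led; clear; lia.
have cardY := subset_leq_card sYY'.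
have := trade_off #|Y| #|Q'| (subset_leq_card sX'X) (max_card [in X]) led'.
rewrite subnKC // cardQ; move: leQ; rewrite [((_ + _) * #|X|)%N]mulnC.
move: (#|X'| * _)%N (#|X| * _)%N ((#|Y'| - #|Y|) * _)%N (d * _)%N; clear.
by move=> a b e h; move: (\sum_(t in Y) _) (\sum_(s in X') _) (\sum_(t in ~: Y') _); lia.
Qed.

Lemma hull_lower alpha X : lower_condition g p adm alpha ->
  alpha%:Z + hull (raise C q) #|X| <=
  \sum_(s in ~: X) gS' s + \sum_t raise C q [set t].
Proof.
move=> cond; rewrite -lerBrDl; apply: hull_le => P /(gT'_packing #|X|)[Y [Q [sQ ->]]].
rewrite (eq_bigr _ (fun t _ => raise_gT' t)) (sum_setC gT' Y).
have [X' [sXX' finS ->]] := @sum_cap S gS #|T| X (fun s => @g_fin (inl s)).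
have [Y' [sYY' finT ->]] := @sum_cap T gT #|S| Y (fun t => @g_fin (inr t)).
have [Q' [d [sQ' led cardQ leQ]]] := subpartition_drop p_bound sQ sYY'.
have finX' : finite_on gS (~: X') by move=> s; rewrite inE => /finS.
have finY' : finite_on gT (~: Y') by move=> t; rewrite inE => /finT.
have := lower_fine cond sQ' finX' finY'.
have led' : (d <= #|Y'| - #|Y|)%N by move: led; clear; lia.
have cardX := subset_leq_card sXX'; have cardY := subset_leq_card sYY'.
have cardQ' : (#|Y'| + #|Q'| <= #|T|)%N.
  by rewrite -(cardsC Y') leq_add2l subpartition_card.
have leX : (#|X'| * (#|Y'| + #|Q'|) <=
            #|X| * (#|Y'| + #|Q'|) + (#|X'| - #|X|) * #|T|)%N.
  by rewrite -{1}(subnKC cardX) mulnDl leq_add2l leq_mul2l cardQ' orbT.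
have := trade_off #|Y| #|Q'| (leqnn #|X|) (max_card [in X]) led'.
rewrite subnKC // cardQ; move: leQ leX; rewrite [((_ + _) * #|X|)%N]mulnC.
move: (#|X'| * _)%N (#|X| * _)%N (#|X| * _)%N ((#|Y'| - #|Y|) * _)%N (d * _)%N.
move: ((#|X'| - #|X|) * _)%N; clear.
move=> a b e h i j.
by move: (\sum_(t in Y) _) (\sum_(s in ~: X') _) (\sum_(t in ~: Y') _); lia.
Qed.

Lemma hull_upper beta X : upper_condition f p adm beta ->
  \sum_(s in X) fS' s + hull q #|X| <= beta%:Z.
Proof.
move=> cond; rewrite -lerBrDl; apply: hull_le => P /(q_packing #|X|)[Y [Q [sQ finT ->]]].
have [X' [sX'X finS ->]] := @sum_nonneg_part S fS X (fun s => @f_fin (inl s)).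
have := upper_fine cond sQ finS finT.
have : (#|X'| * (#|Y| + #|Q|) <= (#|Y| + #|Q|) * #|X|)%N.
  by rewrite [X in (_ <= X)%N]mulnC leq_mul2r subset_leq_card ?orbT.
move: (#|X'| * _)%N (_ * #|X|)%N; clear.
by move=> a b; move: (\sum_(t in Y) _) (\sum_(s in X') _); lia.
Qed.

Lemma fS'_ge0 s : 0 <= fS' s.
Proof. by rewrite /fS' /nonneg_part; case: (fS s) => // r; rewrite le_max lexx orbT. Qed.

Lemma gT'_le t : gT' t <= #|S|%:Z.
Proof. by rewrite /gT' /cap; case: (gT t) => // r; rewrite ge_min lexx orbT. Qed.

Lemma gS'_le s : gS' s <= #|T|%:Z.
Proof. by rewrite /gS' /cap; case: (gS s) => // r; rewrite ge_min lexx orbT. Qed.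

(** Together with [hull_upper_max], this lets [realize] run with the trivial bounds 0 and
    [#|S| * #|T|] where no bound on the number of edges is prescribed. *)
Lemma hull_lower0 X :
  0%:Z + hull (raise C q) #|X| <= \sum_(s in ~: X) gS' s + \sum_t raise C q [set t].
Proof.
rewrite add0r; have := hull_fS' X.
have : 0 <= \sum_(s in X) fS' s by apply: sumr_ge0 => s _; apply: fS'_ge0.
have : 0 <= \sum_(s in ~: X) gS' s by apply: sumr_ge0 => s _; apply: gS'_ge0.
by clear; lia.
Qed.

Lemma hull_upper_max X : \sum_(s in X) fS' s + hull q #|X| <= (#|S| * #|T|)%N%:Z.
Proof.
apply: le_trans (lerD (lexx _) (hull_gS' X)) _.
apply: (@le_trans _ _ (\sum_s gS' s)).
  by rewrite (sum_setC gS' X) lerD2r; apply: ler_sum => s _; apply: fS'_le_gS'.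
apply: (@le_trans _ _ (\sum_(s : S) #|T|%:Z)).
  by apply: ler_sum => s _; apply: gS'_le.
by rewrite sumr_const -mulr_natr natz PoszM mulrC.
Qed.

(** Supplies the inequality between the two bounds that [realize] asks for when the upper one is
    trivial. *)
Lemma lower_le alpha : lower_condition g p adm alpha -> (alpha <= #|S| * #|T|)%N.
Proof.
move=> cond; have := hull_lower setT cond; rewrite setCT big_set0 add0r => le.
rewrite -lez_nat; apply: (@le_trans _ _ (\sum_t raise C q [set t])).
  by apply: le_trans le; rewrite lerDl hull_ge0.
apply: (@le_trans _ _ (\sum_(t : T) #|S|%:Z)).
  by apply: ler_sum => t _; rewrite raise_gT' gT'_le.
by rewrite sumr_const -mulr_natr natz PoszM.
Qed.

Lemma realize alpha beta :
  (forall X, alpha%:Z + hull (raise C q) #|X| <=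
     \sum_(s in ~: X) gS' s + \sum_t raise C q [set t]) ->
  (forall X, \sum_(s in X) fS' s + hull q #|X| <= beta%:Z) ->
  (alpha <= beta)%N ->
  exists E, realization f g p E /\ (alpha <= #|E| <= beta)%N.
Proof.
move=> ha hb leab.
have q0 : q set0 <= 0 by rewrite /q raise_id ?cards0 // p0.
have [E [covE degS degT cardE]] :=
  bounded_cover pis_q q0 fS'_le_gS' hull_gS' hull_fS' ha hb leab.
exists E; split=> //; split=> [W|[s|t]].
- exact: le_trans (le_raise c p W) (covE W).
- have /andP[ge le] := degS s; split.
    move: ge; rewrite /fS' /nonneg_part; rewrite -/(fS s).
    case fs : (fS s) (@f_fin (inl s)) => [r||] //.
    by move=> _; rewrite lee_fin; apply: le_trans; rewrite le_max lexx.
  move: le; rewrite /gS' /cap; rewrite -/(gS s).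
  case gs : (gS s) (@g_fin (inl s)) => [r||] //.
  by move=> _; rewrite lee_fin => /le_trans; apply; rewrite ge_min lexx.
have /andP[ge le] := degT t; split.
  rewrite -/(fT t); case ft : (fT t) (@f_fin (inr t)) => [r||] //.
  by move=> _; rewrite lee_fin (le_trans (fT_le_q ft)).
move: le; rewrite -raise_set1 raise_gT' /gT' /cap; rewrite -/(gT t).
case gt : (gT t) (@g_fin (inr t)) => [r||] //.
by move=> _; rewrite lee_fin => /le_trans; apply; rewrite ge_min lexx.
Qed.

Lemma characterization alpha beta : (alpha <= beta)%N ->
  [/\ exists E, realization f g p E,
      (exists E, realization f g p E /\ (alpha <= #|E|)%N)
        <-> lower_condition g p adm alpha,
      (exists E, realization f g p E /\ (#|E| <= beta)%N)
        <-> upper_condition f p adm beta &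
      (exists E, realization f g p E /\ (alpha <= #|E| <= beta)%N)
        <-> lower_condition g p adm alpha /\ upper_condition f p adm beta].
Proof.
move=> leab; split.
- by have [E [rE _]] := realize hull_lower0 hull_upper_max (leq0n _); exists E.
- split=> [[E [rE leE]]|cond]; first exact: lower_necessary rE leE.
  have [E [rE /andP[leE _]]] :=
    realize (fun X => hull_lower X cond) hull_upper_max (lower_le cond).
  by exists E.
- split=> [[E [rE leE]]|cond]; first exact: upper_necessary rE leE.
  have [E [rE /andP[_ leE]]] := realize hull_lower0 (fun X => hull_upper X cond) (leq0n _).
  by exists E.
split=> [[E [rE /andP[leE geE]]]|[condl condu]].
  by split; [apply: lower_necessary rE leE | apply: upper_necessary rE geE].
exact: realize (fun X => hull_lower X condl) (fun X => hull_upper X condu) leab.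
Qed.

End Reduction.

(** * The three classes of subpartitions *)

Theorem theorem17 (S T : finType) (f g : S + T -> \bar int)
    (p : {set T} -> int) (alpha beta : nat)
    (f_fin : forall v, f v <> +oo%E) (g_fin : forall v, g v <> -oo%E)
    (le_fg : forall v, (f v <= g v)%E)
    (p_super : pos_intersecting_supermodular p)
    (p_set0 : p set0 = 0)
    (p_bound : forall Y : {set T}, p Y <= #|S|%:Z)
    (le_alpha_beta : (alpha <= beta)%N) :
  [/\ size_characterization f g p (@any_subpartition T) alpha beta,
      fully_supermodular p ->
        size_characterization f g p (@at_most_one_member T) alpha beta &
      fully_supermodular p -> monotone_nondecreasing p ->
        size_characterization f g p (@empty_or_whole T) alpha beta].
Proof.
have sum1 W : sumP p [set W] = p W by rewrite /sumP big_set1.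
split=> [|fsup|fsup mono] feas; apply: characterization feas _ _ _ => // Y P sP.
- by exists P.
- have [P0|nP0] := eqVneq P set0.
    by exists P; split=> //; rewrite /at_most_one_member P0 cards0.
  have pP := subpartition_packing sP; have /set0Pn[W PW] := nP0.
  have nC0 : cover P != set0.
    have /set0Pn[t Wt] := mem_packing pP PW.
    by apply/set0Pn; exists t; apply: in_cover Wt.
  (* By supermodularity, merging all members into their union does not decrease the value, and it
     does not increase the number of members. *)
  exists [set cover P]; split=> [||x].
  + by apply: subpartition1 nC0 _; case/and3P: sP.
  + by rewrite /at_most_one_member cards1.
  have cardP : (x <= #|P| * x)%N by rewrite leq_pmull // card_gt0.
  by have := sumP_cover fsup p_set0 pP; rewrite sum1 cards1; lia.
have [P0|nP0] := eqVneq P set0.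
  by exists P; split=> //; rewrite /empty_or_whole P0 eqxx.
have pP := subpartition_packing sP; have /set0Pn[W PW] := nP0.
have nC0 : cover P != set0.
  have /set0Pn[t Wt] := mem_packing pP PW.
  by apply/set0Pn; exists t; apply: in_cover Wt.
have sPY : cover P \subset ~: Y by case/and3P: sP.
(* Monotonicity allows the union of the members to be enlarged to the whole complement of [Y]. *)
exists [set ~: Y]; split=> [||x].
- apply: subpartition1 (subxx _); apply: contraNneq nC0 => Y0.
  by rewrite -subset0 -Y0.
- by rewrite /empty_or_whole eqxx orbT.
have cardP : (x <= #|P| * x)%N by rewrite leq_pmull // card_gt0.
have := mono _ _ nC0 sPY; have := sumP_cover fsup p_set0 pP.
by rewrite sum1 cards1; lia.
Qed.
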